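(* Let $0<a\le1$ and $z_1,z_2\in\mathbb{C}$ with $0<|z_1|,|z_2|\le 1$. For $\vec\sigma=(\sigma_1,\sigma_2)$ with $\sigma_1>0$, $\sigma_2>1$, $\sigma_1+\sigma_2>2$ and $\vec t=(t_1,t_2)\in\mathbb{R}^2$ put $$f_{\vec\sigma,a,\vec z}(\vec t):=\Gamma(\sigma_1+{\rm i}t_1)\Gamma(\sigma_2+{\rm i}t_2)\,\Phi_2(\sigma_1+{\rm i}t_1,\sigma_2+{\rm i}t_2,a,z_1,z_2),\qquad F_{\vec\sigma,a,\vec z}(\vec t):=\frac{f_{\vec\sigma,a,\vec z}(\vec t)}{f_{\vec\sigma,a,\vec z}(\vec 0)}.$$ Then $F_{\vec\sigma,a,\vec z}$ is the characteristic function of a probability measure on $\mathbb{R}^2$ for all $\sigma_1>0$, $\sigma_2>1$, $\sigma_1+\sigma_2>2$ if and only if $z_1,z_2\in[-1,1]$ (both nonzero). Moreover, in that case the associated probability measure is absolutely continuous with density $$P_{\vec\sigma,a,\vec z}(\eta,\theta)=\frac{e^{\sigma_1\eta}e^{\sigma_2\theta}\exp\bigl((1-a)(e^\eta+e^\theta)\bigr)}{f_{\vec\sigma,a,\vec z}(\vec0)\,(\exp(e^\theta)-z_2)\,(\exp(e^\eta+e^\theta)-z_1)},\qquad \eta,\theta\in\mathbb{R}.$$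
   Context: For $0<a\le1$, $s_1,s_2\in\mathbb{C}$ and $z_1,z_2\in\mathbb{C}$ with $0<|z_1|,|z_2|\le1$, the Hurwitz–Lerch type Euler–Zagier double zeta function is $$\Phi_2(s_1,s_2,a,z_1,z_2):=\sum_{m=0}^\infty\frac{z_1^m}{(m+a)^{s_1}}\sum_{n=1}^\infty\frac{z_2^{n-1}}{(m+n+a)^{s_2}},$$ which converges absolutely for $\Re s_1>0$, $\Re s_2>1$, $\Re(s_1+s_2)>2$ and continues meromorphically to $\mathbb{C}^2$. The characteristic function of a probability measure $\mu$ on $\mathbb{R}^2$ is $\int_{\mathbb{R}^2}e^{{\rm i}(t_1\eta+t_2\theta)}\mu(d\eta\,d\theta)$. *)

(* Defs.v *)
From HB Require Import structures.
From mathcomp Require Import all_boot all_order all_algebra.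
From mathcomp Require Import all_classical all_reals all_analysis.
From mathcomp Require Import complex.
Set Implicit Arguments. Unset Strict Implicit. Unset Printing Implicit Defensive.
Import Order.TTheory GRing.Theory Num.Theory.
Import numFieldNormedType.Exports.
Local Open Scope classical_set_scope.
Local Open Scope ring_scope.
Local Open Scope complex_scope.

Section Defs.
Variable R : realType.

(* x^{-s} = exp(-s log x) for x > 0 and s = sigma + i tau :
   x^{-sigma} (cos(-tau log x) + i sin(-tau log x)). *)
Definition cpowN (x : R) (s : R[i]) : R[i] :=
  (x `^ (- complex.Re s) * cos (- complex.Im s * ln x))
  +i* (x `^ (- complex.Re s) * sin (- complex.Im s * ln x)).

Definition csum (u : nat -> R[i]) : R[i] :=
  (limn (fun N => \sum_(0 <= k < N) complex.Re (u k)))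
  +i* (limn (fun N => \sum_(0 <= k < N) complex.Im (u k))).

(* Hurwitz-Lerch type Euler-Zagier double zeta function, in its region of
   absolute convergence:
   sum_{m>=0} z1^m (m+a)^{-s1} sum_{n>=1} z2^{n-1} (m+n+a)^{-s2}. *)
Definition Phi2 (s1 s2 : R[i]) (a : R) (z1 z2 : R[i]) : R[i] :=
  csum (fun m => z1 ^+ m * cpowN (m%:R + a) s1 *
     csum (fun n => z2 ^+ n * cpowN (m%:R + n.+1%:R + a) s2)).

(* Euler Gamma function for Re s > 0:
   Gamma(s) = int_0^oo x^{s-1} e^{-x} dx, with x^{i tau} = e^{i tau ln x}. *)
Definition cGamma (s : R[i]) : R[i] :=
  (Rintegral lebesgue_measure `]0, +oo[
     (fun x => x `^ (complex.Re s - 1) * expR (- x) * cos (complex.Im s * ln x)))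
  +i*
  (Rintegral lebesgue_measure `]0, +oo[
     (fun x => x `^ (complex.Re s - 1) * expR (- x) * sin (complex.Im s * ln x))).

Definition fsig (sig1 sig2 a : R) (z1 z2 : R[i]) (t1 t2 : R) : R[i] :=
  cGamma (sig1 +i* t1) * cGamma (sig2 +i* t2) *
  Phi2 (sig1 +i* t1) (sig2 +i* t2) a z1 z2.

Definition Fsig (sig1 sig2 a : R) (z1 z2 : R[i]) (t1 t2 : R) : R[i] :=
  fsig sig1 sig2 a z1 z2 t1 t2 / fsig sig1 sig2 a z1 z2 0 0.

Definition charfun2 (mu : probability (R * R)%type R) (t1 t2 : R) : R[i] :=
  (Rintegral mu setT (fun p : R * R => cos (t1 * p.1 + t2 * p.2)))
  +i* (Rintegral mu setT (fun p : R * R => sin (t1 * p.1 + t2 * p.2))).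

(* The density P_{sigma,a,z}(eta,theta), for real z1 z2 (given as complex
   numbers; their real parts are used).  f(0) is then real, and its real
   part is used. *)
Definition Pdens (sig1 sig2 a : R) (z1 z2 : R[i]) (p : R * R) : R :=
  let eta := p.1 in let theta := p.2 in
  expR (sig1 * eta) * expR (sig2 * theta) *
  expR ((1 - a) * (expR eta + expR theta)) /
  (complex.Re (fsig sig1 sig2 a z1 z2 0 0) *
   (expR (expR theta) - complex.Re z2) *
   (expR (expR eta + expR theta) - complex.Re z1)).

End Defs.

(* Main.v *)
Require Import Defs.
From HB Require Import structures.
From mathcomp Require Import all_boot all_order all_algebra.
From mathcomp Require Import all_classical all_reals all_analysis measurable_realfun.
From mathcomp Require Import complex.
From mathcomp Require Import ring lra.
Import Order.TTheory GRing.Theory Num.Theory.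
Import numFieldNormedType.Exports.
Local Open Scope classical_set_scope.
Local Open Scope ring_scope.
Local Open Scope complex_scope.
Set Implicit Arguments. Unset Strict Implicit. Unset Printing Implicit Defensive.

(** The substitution [x = e^eta] turns [Gamma(s) c^(-s)] into the integral over the
    line of [exp (s eta - c e^eta)].  Summing the two geometric series under the
    integral (dominated convergence) exhibits [f(t)] as the Fourier transform of
      [K = e^(sigma1 eta + sigma2 theta) e^((1 - a)(e^eta + e^theta)) /
           ((exp (e^theta) - z2) (exp (e^eta + e^theta) - z1))].
    For real [z1, z2] the kernel is positive, so [K / f(0)] is a probability density.
    Conversely, if [f / f(0)] is a characteristic function, it takes conjugate values
    at [t] and [-t], so [Im (K / f(0))] has zero Fourier transform and vanishes almost
    everywhere.  By continuity [f(0) (Y - z2) (W - z1)] is then real for all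
    [1 < Y < W], and comparing coefficients [f(0)], [f(0) z1] and [f(0) z2] are real.

    A characteristic function determines its measure for the following reason.
    Given two finite measures with the same one, consider the bounded functions [f]
    such that [f e^(i t p)] has the same integral against both, for every [t].  The
    functions [g] by which this class is stable under multiplication form an algebra
    closed under bounded pointwise limits and containing every [sin (t p - c)].
    Polynomials in the latter approximate indicators of half-planes, so indicators of
    all measurable sets belong to the algebra. *)

(** * Step functions as limits of polynomials *)

Lemma bernoulli_inequality (R : realDomainType) (x : R) n :
  -1 <= x -> 1 + n%:R * x <= (1 + x) ^+ n.
Proof.
move=> x1; elim: n => [|n IHn]; first by rewrite mul0r addr0 expr0.
have x10 : 0 <= 1 + x by rewrite -lerBlDl sub0r.
rewrite exprSr; apply: le_trans (ler_wpM2r x10 IHn).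
rewrite -subr_ge0 (_ : _ - _ = n%:R * x ^+ 2); last by rewrite -natr1; ring.
by rewrite mulr_ge0 ?sqr_ge0.
Qed.

Lemma norm_cos_le1 {R : realType} (x : R) : `|cos x| <= 1.
Proof. by rewrite ler_norml cos_geN1 cos_le1. Qed.

Lemma norm_sin_le1 {R : realType} (x : R) : `|sin x| <= 1.
Proof. by rewrite ler_norml sin_geN1 sin_le1. Qed.

Section step_polynomials.
Context {R : realType}.
Implicit Types u : R.

(** Write [r = q ^ 2] and [q^-1 = 1 + h]. Bernoulli's inequality bounds [n q^n] by [h^-1], and the
    other factor [q^n] still tends to [0]. *)
Lemma cvg_linear_geometric (r : R) : 0 <= r < 1 -> n%:R * r ^+ n @[n --> \oo] --> (0 : R).
Proof.
move=> /andP[r0 r1]; have [->|rn0] := eqVneq r 0.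
  apply: cvg_near_cst; near=> n.
  by rewrite expr0n; case: eqP => [->|_]; rewrite ?mul0r ?mulr0.
have rp : 0 < r by rewrite lt0r rn0.
set q := Num.sqrt r; have q0 : 0 < q by rewrite sqrtr_gt0.
have q1 : q < 1 by rewrite -sqrtr1 ltr_sqrt.
set h := q^-1 - 1; have h0 : 0 < h by rewrite subr_gt0 invf_gt1.
have le n : n%:R * r ^+ n <= h^-1 * q ^+ n.
  have bern : 1 + n%:R * h <= q^-1 ^+ n.
    rewrite (_ : q^-1 = 1 + h); last by rewrite /h; ring.
    by apply: bernoulli_inequality; lra.
  have nh : n%:R * h * q ^+ n <= 1.
    apply: (@le_trans _ _ (q^-1 ^+ n * q ^+ n)).
      by rewrite ler_wpM2r ?exprn_ge0 ?(ltW q0)//; lra.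
    by rewrite -exprMn mulVf ?gt_eqF// expr1n.
  rewrite -(sqr_sqrtr r0) -/q exprAC expr2 mulrA ler_wpM2r ?exprn_ge0 ?(ltW q0)//.
  by rewrite -[leRHS]mulr1 ler_pdivlMl// mulrA (mulrC h).
apply: (@squeeze_cvgr _ _ _ _ (fun=> 0) (fun n => h^-1 * q ^+ n)).
- by near=> n; rewrite le mulr_ge0 ?exprn_ge0.
- exact: cvg_cst.
- rewrite -(mulr0 h^-1); apply: cvgM; first exact: cvg_cst.
  by apply: cvg_expr; rewrite ger0_norm // ltW.
Unshelve. all: end_near. Qed.

(* The factor [n] in the exponent forces convergence at [u = 1/2] as well. *)
Definition step_poly (n : nat) u : R := 1 - (1 - u ^+ n) ^+ (n * 2 ^ n).

Lemma step_poly_itv n u : 0 <= u <= 1 -> 0 <= step_poly n u <= 1.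
Proof.
move=> /andP[u0 u1]; have un0 : 0 <= u ^+ n by rewrite exprn_ge0.
have un1 : u ^+ n <= 1 by rewrite exprn_ile1.
have v0 : 0 <= 1 - u ^+ n by rewrite subr_ge0.
rewrite /step_poly subr_ge0 exprn_ile1//=; last by rewrite gerBl.
by rewrite gerBl exprn_ge0.
Qed.

(** Put [v = u^n] and [N = n 2^n], so that [N v = n (2 u)^n]. If [u >= 1/2], then [(1 - v)^N <= (1 +
    v)^-N <= (1 + N v)^-1 <= (1 + n)^-1]. If [u < 1/2], then [1 - (1 - v)^N <= N v], which tends to
    [0]. Both estimates are instances of Bernoulli's inequality. *)
Lemma step_poly_cvg u : 0 <= u <= 1 ->
  step_poly n u @[n --> \oo] --> ((2^-1 <= u)%R%:R : R).
Proof.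
move=> u01; have /andP[u0 u1] := u01.
have un0 n : 0 <= u ^+ n by rewrite exprn_ge0.
have un1 n : u ^+ n <= 1 by rewrite exprn_ile1.
have NvE n : (n * 2 ^ n)%:R * u ^+ n = n%:R * (2 * u) ^+ n.
  by rewrite natrM natrX -mulrA -exprMn.
have [uge|ult] := leP 2^-1 u.
  have le n : 1 - n.+1%:R^-1 <= step_poly n u.
    rewrite lerD2l lerN2.
    have den0 : 0 < 1 + (n * 2 ^ n)%:R * u ^+ n.
      by rewrite ltr_pwDl// mulr_ge0.
    apply: (@le_trans _ _ (1 + (n * 2 ^ n)%:R * u ^+ n)^-1).
      rewrite -[leRHS]mul1r ler_pdivlMr//.
      apply: (@le_trans _ _ ((1 - u ^+ n) ^+ (n * 2 ^ n) * (1 + u ^+ n) ^+ (n * 2 ^ n))).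
        rewrite ler_wpM2l ?exprn_ge0 ?subr_ge0// bernoulli_inequality//.
        by rewrite (le_trans _ (un0 n)) ?lerN10.
      rewrite -exprMn exprn_ile1//.
        by rewrite mulr_ge0 ?subr_ge0 ?addr_ge0.
      by rewrite -subr_sqr expr1n gerBl sqr_ge0.
    rewrite lef_pV2 ?posrE// NvE -natr1 addrC lerD2l ler_peMr//.
    by rewrite exprn_ege1//; lra.
  apply: (@squeeze_cvgr _ _ _ _ (fun n => 1 - n.+1%:R^-1) (fun=> 1)).
  - by near=> n; rewrite le; case/andP: (step_poly_itv n u01).
  - rewrite -[X in _ --> X]subr0; apply: cvgB; first exact: cvg_cst.
    exact: cvg_harmonic.
  - exact: cvg_cst.
apply: (@squeeze_cvgr _ _ _ _ (fun=> 0) (fun n => n%:R * (2 * u) ^+ n)).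
- near=> n; case/andP: (step_poly_itv n u01) => -> _ /=.
  rewrite -NvE /step_poly lerBlDl -lerBlDr.
  have /(@bernoulli_inequality R) : -1 <= - u ^+ n by rewrite lerN2.
  by move=> /(_ (n * 2 ^ n)%N); rewrite mulrN.
- exact: cvg_cst.
- by apply: cvg_linear_geometric; apply/andP; split; lra.
Unshelve. all: end_near. Qed.

(** Once [|x| / (n + 1) < pi], the sine has the sign of its argument, so the sequence is eventually
    constant. This recovers a half-plane from periodic functions of growing period. *)
Lemma sin_step_cvg (x : R) : 
  ((0 <= sin (x / n.+1%:R))%R%:R : R) @[n --> \oo] --> ((0 <= x)%R%:R : R).
Proof.
have pi0 := pi_gt0 R.
have lt : \forall n \near \oo, `|x| / n.+1%:R < pi.
  near=> n; rewrite ltr_pdivrMr// -ltr_pdivrMl//.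
  apply: (@lt_le_trans _ _ n%:R); last by rewrite ler_nat.
  by near: n; apply: nbhs_infty_gtr.
apply: cvg_near_cst; near=> n.
have : `|x| / n.+1%:R < pi by near: n.
have [x0|x0] := leP 0 x; first by rewrite ger0_norm// => xpi; rewrite sin_ge0_pi// divr_ge0//= ltW.
rewrite ltr0_norm// => xpi; rewrite (leNgt 0) -oppr_gt0 -sinN -mulNr.
by rewrite sin_gt0_pi// xpi divr_gt0 ?oppr_gt0.
Unshelve. all: end_near. Qed.

End step_polynomials.

(** * Uniqueness of the characteristic function *)

Section charfun_uniqueness.
Context {R : realType}.
Variables mu nu : {finite_measure set (R * R)%type -> \bar R}.
Implicit Types f g h : R * R -> R.

Definition bounded_measurable f :=
  measurable_fun setT f /\ exists M : R, forall x, `|f x| <= M.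

Definition same_integral f := \int[mu]_x f x = \int[nu]_x f x.

Let phase (t1 t2 : R) (p : R * R) : R := t1 * p.1 + t2 * p.2.

(** The measures [f mu] and [f nu] have the same Fourier transform, split into cosine and sine parts
    to stay real-valued. All frequencies are required so that multiplication by a trigonometric
    function preserves the property. *)
Definition same_fourier f := bounded_measurable f /\
  forall t1 t2, same_integral (fun p => f p * cos (phase t1 t2 p)) /\
                same_integral (fun p => f p * sin (phase t1 t2 p)).

(** [same_fourier] is a linear condition with no evident stability under products. Multipliers
    compose, so they form an algebra. *)
Definition fourier_multiplier g := bounded_measurable g /\
  forall f, same_fourier f -> same_fourier (fun p => g p * f p).

Lemma bounded_measurable_integrable (m : {finite_measure set (R * R)%type -> \bar R}) f :
  bounded_measurable f -> m.-integrable setT (EFin \o f).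
Proof.
move=> [mf [M fM]]; apply: measurable_bounded_integrable => //.
  by rewrite ltey_eq fin_num_measure.
by exists M; split; [exact: num_real | move=> x Mx y _ /=; rewrite (le_trans (fM y)) // ltW].
Qed.

Lemma bounded_measurable_cst c : bounded_measurable (cst c).
Proof. by split; [exact: measurable_cst | exists `|c|]. Qed.

Lemma bounded_measurableD f g :
  bounded_measurable f -> bounded_measurable g -> bounded_measurable (fun x => f x + g x).
Proof.
move=> [mf [M fM]] [mg [N gN]]; split; first exact: measurable_funD.
by exists (M + N) => x; rewrite (le_trans (ler_normD _ _)) ?lerD.
Qed.

Lemma bounded_measurableM f g :
  bounded_measurable f -> bounded_measurable g -> bounded_measurable (fun x => f x * g x).
Proof.
move=> [mf [M fM]] [mg [N gN]]; split; first exact: measurable_funM.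
by exists (M * N) => x; rewrite normrM ler_pM.
Qed.

Lemma measurable_phase t1 t2 : measurable_fun setT (phase t1 t2).
Proof.
by apply: measurable_funD; exact: measurable_funM.
Qed.

Lemma bounded_measurable_cos t1 t2 : bounded_measurable (fun p => cos (phase t1 t2 p)).
Proof.
split; last by exists 1 => x; exact: norm_cos_le1.
apply: measurableT_comp (measurable_phase _ _).
exact: continuous_measurable_fun (@continuous_cos R).
Qed.

Lemma bounded_measurable_sin t1 t2 : bounded_measurable (fun p => sin (phase t1 t2 p)).
Proof.
split; last by exists 1 => x; exact: norm_sin_le1.
apply: measurableT_comp (measurable_phase _ _).
exact: continuous_measurable_fun (@continuous_sin R).
Qed.

Lemma same_integralZ c f : bounded_measurable f ->
  same_integral f -> same_integral (fun x => c * f x).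
Proof.
move=> bf; rewrite /same_integral => ff.
by rewrite !RintegralZl ?ff//; exact: bounded_measurable_integrable.
Qed.

Lemma same_integralD f g : bounded_measurable f -> bounded_measurable g ->
  same_integral f -> same_integral g -> same_integral (fun x => f x + g x).
Proof.
move=> bf bg; rewrite /same_integral => ff gg.
by rewrite !RintegralD ?ff ?gg//; exact: bounded_measurable_integrable.
Qed.

Lemma bounded_measurable_lim (h : nat -> R * R -> R) f (M : R) :
  (forall n, measurable_fun setT (h n)) -> (forall n x, `|h n x| <= M) ->
  (forall x, h n x @[n --> \oo] --> f x) -> bounded_measurable f.
Proof.
move=> mh hM hf; split; first by apply: (measurable_fun_cvg mh) => x _; exact: hf.
exists M => x; have hn : `|h n x| @[n --> \oo] --> `|f x| by exact: cvg_norm (hf x).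
rewrite -(cvg_lim _ hn)//; apply: limr_le; first by apply/cvg_ex; exists `|f x|.
by near=> n.
Unshelve. all: end_near. Qed.

Lemma cvg_Rintegral_bounded (m : {finite_measure set (R * R)%type -> \bar R})
    (h : nat -> R * R -> R) f (M : R) :
  (forall n, measurable_fun setT (h n)) -> (forall n x, `|h n x| <= M) ->
  (forall x, h n x @[n --> \oo] --> f x) ->
  \int[m]_x h n x @[n --> \oo] --> \int[m]_x f x.
Proof.
move=> mh hM hf.
have bf : bounded_measurable f by exact: bounded_measurable_lim hf.
have := bounded_measurable_integrable m bf => /integrable_fin_num/fineK => /(_ measurableT).
rewrite /Rintegral => fE; apply: fine_cvg; rewrite fE.
apply: (@dominated_cvg _ _ _ m setT measurableT _ _ (cst M%:E)) => //=.
- by move=> n; apply/measurable_EFinP; exact: mh.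
- by move=> x _; apply: cvg_EFin; [near=> n | exact: hf].
- exact: finite_measure_integrable_cst.
- by move=> n x _; rewrite lee_fin.
Unshelve. all: end_near. Qed.

Lemma same_integral_lim (h : nat -> R * R -> R) f (M : R) :
  (forall n, measurable_fun setT (h n)) -> (forall n x, `|h n x| <= M) ->
  (forall x, h n x @[n --> \oo] --> f x) ->
  (forall n, same_integral (h n)) -> same_integral f.
Proof.
move=> mh hM hf hs; rewrite /same_integral.
have cmu := cvg_Rintegral_bounded (m := mu) mh hM hf.
have cnu := cvg_Rintegral_bounded (m := nu) mh hM hf.
have E : (fun n => \int[mu]_x h n x) = (fun n => \int[nu]_x h n x) :> (nat -> R).
  by apply/funext => n; exact: hs.
by rewrite E in cmu; exact: (cvg_unique _ cmu cnu).
Qed.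

Lemma same_fourierZ c f : same_fourier f -> same_fourier (fun p => c * f p).
Proof.
move=> [bf H]; split; first exact: bounded_measurableM (bounded_measurable_cst c) bf.
move=> t1 t2; have [H1 H2] := H t1 t2; split.
- have := same_integralZ c (bounded_measurableM bf (bounded_measurable_cos t1 t2)) H1.
  by congr same_integral; apply/funext => p; rewrite mulrA.
- have := same_integralZ c (bounded_measurableM bf (bounded_measurable_sin t1 t2)) H2.
  by congr same_integral; apply/funext => p; rewrite mulrA.
Qed.

Lemma same_fourierD f g :
  same_fourier f -> same_fourier g -> same_fourier (fun p => f p + g p).
Proof.
move=> [bf H] [bg K]; split; first exact: bounded_measurableD.
move=> t1 t2; have [H1 H2] := H t1 t2; have [K1 K2] := K t1 t2.
have bc := bounded_measurable_cos t1 t2; have bs := bounded_measurable_sin t1 t2; split.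
- have := same_integralD (bounded_measurableM bf bc) (bounded_measurableM bg bc) H1 K1.
  by congr same_integral; apply/funext => p; rewrite mulrDl.
- have := same_integralD (bounded_measurableM bf bs) (bounded_measurableM bg bs) H2 K2.
  by congr same_integral; apply/funext => p; rewrite mulrDl.
Qed.

Lemma same_fourier_lim (h : nat -> R * R -> R) f (M : R) :
  (forall n, same_fourier (h n)) -> (forall n x, `|h n x| <= M) ->
  (forall x, h n x @[n --> \oo] --> f x) -> same_fourier f.
Proof.
move=> hs hM hf.
have M0 : 0 <= M by rewrite (le_trans _ (hM 0%N (0, 0))).
have mh n : measurable_fun setT (h n) by case: (hs n) => -[].
split; first exact: bounded_measurable_lim mh hM hf.
move=> t1 t2; split.
- have [mc _] := bounded_measurable_cos t1 t2.
  apply: (same_integral_lim (h := fun n p => h n p * cos (phase t1 t2 p)) (M := M)).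
  + by move=> n; apply: measurable_funM.
  + by move=> n x; rewrite normrM -[leRHS]mulr1 ler_pM // norm_cos_le1.
  + by move=> x; apply: cvgM => //; exact: cvg_cst.
  + by move=> n; case: (hs n) => _ /(_ t1 t2) [].
- have [mc _] := bounded_measurable_sin t1 t2.
  apply: (same_integral_lim (h := fun n p => h n p * sin (phase t1 t2 p)) (M := M)).
  + by move=> n; apply: measurable_funM.
  + by move=> n x; rewrite normrM -[leRHS]mulr1 ler_pM // norm_sin_le1.
  + by move=> x; apply: cvgM => //; exact: cvg_cst.
  + by move=> n; case: (hs n) => _ /(_ t1 t2) [].
Qed.

Lemma fourier_multiplier_cst c : fourier_multiplier (cst c).
Proof.
split; first exact: bounded_measurable_cst.
by move=> f; exact: same_fourierZ.
Qed.

Lemma fourier_multiplierD f g : fourier_multiplier f -> fourier_multiplier g ->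
  fourier_multiplier (fun p => f p + g p).
Proof.
move=> [bf H] [bg K]; split; first exact: bounded_measurableD.
move=> h sh; have := same_fourierD (H _ sh) (K _ sh).
by congr same_fourier; apply/funext => p; rewrite mulrDl.
Qed.

Lemma fourier_multiplierM f g : fourier_multiplier f -> fourier_multiplier g ->
  fourier_multiplier (fun p => f p * g p).
Proof.
move=> [bf H] [bg K]; split; first exact: bounded_measurableM.
move=> h sh; have := H _ (K _ sh).
by congr same_fourier; apply/funext => p; rewrite mulrA.
Qed.

Lemma fourier_multiplierB f g : fourier_multiplier f -> fourier_multiplier g ->
  fourier_multiplier (fun p => f p - g p).
Proof.
move=> Mf Mg.
have := fourier_multiplierD Mf (fourier_multiplierM (fourier_multiplier_cst (-1)) Mg).
by congr fourier_multiplier; apply/funext => p; rewrite mulN1r.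
Qed.

Lemma fourier_multiplierX f n : fourier_multiplier f ->
  fourier_multiplier (fun p => f p ^+ n).
Proof.
move=> Mf; elim: n => [|n IHn]; first exact: fourier_multiplier_cst.
have := fourier_multiplierM Mf IHn.
by congr fourier_multiplier; apply/funext => p; rewrite exprS.
Qed.

Lemma fourier_multiplier_lim (h : nat -> R * R -> R) f (M : R) :
  (forall n, fourier_multiplier (h n)) -> (forall n x, `|h n x| <= M) ->
  (forall x, h n x @[n --> \oo] --> f x) -> fourier_multiplier f.
Proof.
move=> hs hM hf; split.
  by apply: bounded_measurable_lim hM hf => n; case: (hs n) => -[].
move=> g sg; have [[_ [N gN]] _] := sg.
have M0 : 0 <= M by rewrite (le_trans _ (hM 0%N (0, 0))).
have N0 : 0 <= N by rewrite (le_trans _ (gN (0, 0))).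
apply: (same_fourier_lim (h := fun n p => h n p * g p) (M := M * N)).
- by move=> n; case: (hs n) => _; exact.
- by move=> n x; rewrite normrM ler_pM.
- by move=> x; apply: cvgM => //; exact: cvg_cst.
Qed.

(** The product-to-sum formulas turn a product of trigonometric functions at frequencies [s] and [t]
    into half a sum or difference of such functions at [s + t] and [s - t]. *)
Lemma fourier_multiplier_cos_sin s1 s2 :
  fourier_multiplier (fun p => cos (phase s1 s2 p)) /\
  fourier_multiplier (fun p => sin (phase s1 s2 p)).
Proof.
have bc := bounded_measurable_cos; have bs := bounded_measurable_sin.
have phD t1 t2 p : phase s1 s2 p + phase t1 t2 p = phase (s1 + t1) (s2 + t2) p.
  by rewrite /phase; ring.
have phB t1 t2 p : phase s1 s2 p - phase t1 t2 p = phase (s1 - t1) (s2 - t2) p.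
  by rewrite /phase; ring.
split; split => // f [bf H]; split; try exact: bounded_measurableM.
- move=> t1 t2; have [HDc HDs] := H (s1 + t1) (s2 + t2); have [HBc HBs] := H (s1 - t1) (s2 - t2).
  have bM := bounded_measurableM bf; split.
  + have := same_integralZ 2^-1 (bounded_measurableD (bM _ (bc _ _)) (bM _ (bc _ _)))
      (same_integralD (bM _ (bc _ _)) (bM _ (bc _ _)) HBc HDc).
    congr same_integral; apply/funext => p; rewrite -phB -phD cosB cosD.
    by field.
  + have := same_integralZ 2^-1 (bounded_measurableD (bM _ (bs _ _))
        (bounded_measurableM (bounded_measurable_cst (-1)) (bM _ (bs _ _))))
      (same_integralD (bM _ (bs _ _)) (bounded_measurableM (bounded_measurable_cst (-1)) (bM _ (bs _ _)))
        HDs (same_integralZ (-1) (bM _ (bs _ _)) HBs)).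
    congr same_integral; apply/funext => p; rewrite -phB -phD sinB sinD /=.
    by field.
- move=> t1 t2; have [HDc HDs] := H (s1 + t1) (s2 + t2); have [HBc HBs] := H (s1 - t1) (s2 - t2).
  have bM := bounded_measurableM bf; split.
  + have := same_integralZ 2^-1 (bounded_measurableD (bM _ (bs _ _)) (bM _ (bs _ _)))
      (same_integralD (bM _ (bs _ _)) (bM _ (bs _ _)) HBs HDs).
    congr same_integral; apply/funext => p; rewrite -phB -phD sinB sinD.
    by field.
  + have := same_integralZ 2^-1 (bounded_measurableD (bM _ (bc _ _))
        (bounded_measurableM (bounded_measurable_cst (-1)) (bM _ (bc _ _))))
      (same_integralD (bM _ (bc _ _)) (bounded_measurableM (bounded_measurable_cst (-1)) (bM _ (bc _ _)))
        HBc (same_integralZ (-1) (bM _ (bc _ _)) HDc)).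
    congr same_integral; apply/funext => p; rewrite -phB -phD cosB cosD /=.
    by field.
Qed.

Lemma fourier_multiplier_sin_affine t1 t2 c :
  fourier_multiplier (fun p => sin (phase t1 t2 p - c)).
Proof.
have [Mc Ms] := fourier_multiplier_cos_sin t1 t2.
have := fourier_multiplierB (fourier_multiplierM Ms (fourier_multiplier_cst (cos c)))
  (fourier_multiplierM Mc (fourier_multiplier_cst (sin c))).
by congr fourier_multiplier; apply/funext => p; rewrite sinB.
Qed.

(** Two successive limits: [step_poly k] applied to [(1 + sin) / 2] tends to the indicator of a
    nonnegative sine, and these indicators tend to that of the half-plane as the period grows. *)
Lemma fourier_multiplier_halfplane t1 t2 c :
  fourier_multiplier (fun p => (c <= phase t1 t2 p)%R%:R).
Proof.
apply: (fourier_multiplier_lim (M := 1)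
  (h := fun n p => (0 <= sin ((phase t1 t2 p - c) / n.+1%:R))%R%:R)).
- move=> n; pose u p := (1 + sin ((phase t1 t2 p - c) / n.+1%:R)) / 2.
  have u01 p : 0 <= u p <= 1.
    have := sin_geN1 ((phase t1 t2 p - c) / n.+1%:R).
    have := sin_le1 ((phase t1 t2 p - c) / n.+1%:R).
    by rewrite /u => ? ?; apply/andP; split; lra.
  have Mu : fourier_multiplier u.
    have := fourier_multiplierM (fourier_multiplierD (fourier_multiplier_cst 1)
      (fourier_multiplier_sin_affine (t1 / n.+1%:R) (t2 / n.+1%:R) (c / n.+1%:R)))
      (fourier_multiplier_cst 2^-1).
    congr fourier_multiplier; apply/funext => p; rewrite /u /=.
    by congr ((1 + sin _) / _); rewrite /phase; ring.
  (* For fixed [k] this is a polynomial in the multiplier [u], hence a multiplier. *)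
  apply: (fourier_multiplier_lim (M := 1) (h := fun k p => step_poly k (u p))).
  + move=> k; apply: fourier_multiplierB; first exact: fourier_multiplier_cst.
    apply/fourier_multiplierX/fourier_multiplierB; first exact: fourier_multiplier_cst.
    exact: fourier_multiplierX.
  + move=> k p; have /andP[s0 s1] := step_poly_itv k (u01 p).
    by rewrite ger0_norm.
  + move=> p; have := step_poly_cvg (u01 p).
    suff -> : (2^-1 <= u p) = (0 <= sin ((phase t1 t2 p - c) / n.+1%:R)) by [].
    by rewrite /u -{1}[2^-1]mul1r ler_pM2r ?invr_gt0// lerDl.
- by move=> n x; case: (0 <= _); rewrite ?normr1 ?normr0.
- by move=> x; rewrite -subr_ge0; exact: sin_step_cvg.
Qed.

Lemma fourier_multiplier_sigma_algebra :
  sigma_algebra setT [set A : set (R * R) | fourier_multiplier \1_A].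
Proof.
have MC (A : set (R * R)) : fourier_multiplier \1_A -> fourier_multiplier \1_(~` A).
  move=> MA; have := fourier_multiplierB (fourier_multiplier_cst 1) MA.
  congr fourier_multiplier; apply/funext => p.
  by rewrite !indicE in_setC; case: (p \in A); rewrite ?subrr ?subr0.
split => /=.
- have := fourier_multiplier_cst 0.
  by congr fourier_multiplier; apply/funext => p; rewrite indic0.
- by move=> A MA; rewrite setTD; exact: MC.
- move=> A MA.
  (* The indicator of a finite intersection is a product of indicators. A countable union is then
     the complement of the limit of the decreasing sets [B n]. *)
  pose B n := \bigcap_(k < n) ~` A k.
  have MB n : fourier_multiplier \1_(B n).
    elim: n => [|n IHn].
      have := fourier_multiplier_cst 1; congr fourier_multiplier; apply/funext => p.
      by rewrite indicE mem_set// => k /=; rewrite ltn0.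
    have := fourier_multiplierM IHn (MC _ (MA n)).
    congr fourier_multiplier; apply/funext => p.
    have -> : B n.+1 = B n `&` ~` A n.
      apply/seteqP; split => q /=.
        by move=> Bq; split; [move=> k /= kn; apply: Bq; exact: leqW | by apply: Bq => /=].
      move=> [Bq nAq] k /=; rewrite ltnS leq_eqVlt => /predU1P[-> //|]; exact: Bq.
    by rewrite !indicE in_setI; case: (_ \in B n); rewrite ?mul1r ?mul0r.
  have MlB : fourier_multiplier \1_(~` (\bigcup_k A k)).
    apply: (fourier_multiplier_lim (M := 1) (h := fun n => \1_(B n))) => //.
      by move=> n p; rewrite indicE; case: (_ \in _); rewrite ?normr1 ?normr0.
    (* At [p] the indicator of [B n] is [0] as soon as [n] exceeds some [k] with [p] in [A k], and
       is always [1] if there is no such [k]. *)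
    move=> p; apply: cvg_near_cst.
    have [[k _ Akp]|nA] := pselect ((\bigcup_k A k) p).
      near=> n; have kn : (k < n)%N by near: n; exact: nbhs_infty_gt.
      rewrite !indicE !memNset//; last by move=> /(_ k kn).
      by move=> /=; apply; exists k.
    near=> n; rewrite !indicE !mem_set// => k _ Akp; apply: nA; by exists k.
  by rewrite -(setCK (\bigcup_k A k)); exact: MC.
Unshelve. all: end_near. Qed.

(** The sets [B] with this property form a sigma-algebra, which contains the generating half-lines
    because their preimages are half-planes. *)
Lemma fourier_multiplier_preimage (t1 t2 : R) (B : set R) : measurable B ->
  fourier_multiplier \1_(phase t1 t2 @^-1` B).
Proof.
move: B; suff : (@measurable _ R) `<=`
    [set B | fourier_multiplier \1_(phase t1 t2 @^-1` B)] by exact.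
have [S0 SC SU] := fourier_multiplier_sigma_algebra.
rewrite [measurable](RGenCInfty.measurableE R).
apply: smallest_sub.
  split=> /=.
  - by rewrite preimage_set0; exact: S0.
  - by move=> A MA; rewrite setTD preimage_setC -setTD; exact: SC.
  - by move=> A MA; rewrite preimage_bigcup; exact: SU.
move=> _ [x ->] /=; have := fourier_multiplier_halfplane t1 t2 x.
congr fourier_multiplier; apply/funext => p; rewrite indicE /=; congr (_ : bool)%:R.
by apply/idP/idP => [xp|]; [rewrite inE/= in_itv/= xp | rewrite inE/= in_itv/= andbT].
Qed.

Lemma charfun_measure_unique :
  (forall t1 t2, same_integral (fun p => cos (t1 * p.1 + t2 * p.2)) /\
                 same_integral (fun p => sin (t1 * p.1 + t2 * p.2))) ->
  forall A, measurable A -> mu A = nu A.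
Proof.
move=> H.
(* The hypothesis says exactly that the constant [1] belongs to the class on which multipliers
   act. *)
have s1 : same_fourier (cst 1).
  split; first exact: bounded_measurable_cst.
  move=> t1 t2; have [Hc Hs] := H t1 t2; split.
  - by move: Hc; congr same_integral; apply/funext => p; rewrite /phase mul1r.
  - by move: Hs; congr same_integral; apply/funext => p; rewrite /phase mul1r.
have Mall : (@measurable _ (R * R)%type) `<=` [set A | fourier_multiplier \1_A].
  apply: smallest_sub; first exact: fourier_multiplier_sigma_algebra.
  move=> _ [|] [B mB <-]; rewrite setTI /=.
  - have <- : phase 1 0 = fst by apply/funext => p; rewrite /phase mul1r mul0r addr0.
    exact: fourier_multiplier_preimage.
  - have <- : phase 0 1 = snd by apply/funext => p; rewrite /phase mul1r mul0r add0r.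
    exact: fourier_multiplier_preimage.
(* Applying the multiplier [\1_A] to the constant [1] and reading the result at frequency zero
   leaves the integrals of [\1_A]. *)
move=> A mA; have [_ /(_ _ s1) [_ /(_ 0 0) [+ _]]] := Mall _ mA.
rewrite /same_integral.
under eq_Rintegral do rewrite /phase !mul0r addr0 cos0 !mulr1.
under [in X in _ = X -> _]eq_Rintegral do rewrite /phase !mul0r addr0 cos0 !mulr1.
rewrite /Rintegral !integral_indic// !setIT => E.
by rewrite -[LHS]fineK ?fin_num_measure// E fineK ?fin_num_measure.
Qed.

End charfun_uniqueness.

(** * Complex-valued sequences and integrals *)

Import complex.ComplexField.Normc.

Section complex_sequences.
Context {R : realType}.
Implicit Types (z w c l : R[i]) (u : nat -> R[i]).

Lemma ReD z w : complex.Re (z + w) = complex.Re z + complex.Re w.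
Proof. by case: z; case: w. Qed.
Lemma ImD z w : complex.Im (z + w) = complex.Im z + complex.Im w.
Proof. by case: z; case: w. Qed.
Lemma ReM z w : complex.Re (z * w) =
  complex.Re z * complex.Re w - complex.Im z * complex.Im w.
Proof. by case: z; case: w. Qed.
Lemma ImM z w : complex.Im (z * w) =
  complex.Re z * complex.Im w + complex.Im z * complex.Re w.
Proof. by case: z; case: w. Qed.

Lemma Re_sum (I : Type) (r : seq I) (F : I -> R[i]) :
  complex.Re (\sum_(k <- r) F k) = \sum_(k <- r) complex.Re (F k).
Proof. by apply: big_morph; [exact: ReD |]. Qed.
Lemma Im_sum (I : Type) (r : seq I) (F : I -> R[i]) :
  complex.Im (\sum_(k <- r) F k) = \sum_(k <- r) complex.Im (F k).
Proof. by apply: big_morph; [exact: ImD |]. Qed.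

Lemma complexP z w : complex.Re z = complex.Re w -> complex.Im z = complex.Im w -> z = w.
Proof. by case: z => ? ?; case: w => ? ? /= -> ->. Qed.

Lemma norm_Re_le z : `|complex.Re z| <= normc z.
Proof. by case: z => a b /=; rewrite -sqrtr_sqr ler_wsqrtr// lerDl sqr_ge0. Qed.
Lemma norm_Im_le z : `|complex.Im z| <= normc z.
Proof. by case: z => a b /=; rewrite -sqrtr_sqr ler_wsqrtr// lerDr sqr_ge0. Qed.

Lemma normc_ge0 z : 0 <= normc z.
Proof. by case: z => a b /=; rewrite sqrtr_ge0. Qed.

Lemma normc_real (x : R) : normc x%:C = `|x|.
Proof. by rewrite /= expr0n addr0 sqrtr_sqr. Qed.

Lemma normcX z n : normc (z ^+ n) = normc z ^+ n.
Proof.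
elim: n => [|n IHn]; first by rewrite !expr0 normc1.
by rewrite !exprS normcM IHn.
Qed.

(** Componentwise convergence matches [csum], which takes the limits of real and imaginary parts
    separately. *)
Definition ccvg u l :=
  (complex.Re (u n) @[n --> \oo] --> complex.Re l) /\
  (complex.Im (u n) @[n --> \oo] --> complex.Im l).

Lemma ccvg_unique u l l' : ccvg u l -> ccvg u l' -> l = l'.
Proof.
move=> [ur ui] [ur' ui'].
by apply: complexP; [exact: cvg_unique ur ur' | exact: cvg_unique ui ui'].
Qed.

Lemma ccvg_cst l : ccvg (fun=> l) l.
Proof. by split; exact: cvg_cst. Qed.

Lemma ccvgMl c u l : ccvg u l -> ccvg (fun n => c * u n) (c * l).
Proof.
move=> [ur ui]; split; rewrite ?ReM ?ImM.
- under eq_fun do rewrite ReM.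
  by apply: cvgB; apply: cvgM => //; exact: cvg_cst.
- under eq_fun do rewrite ImM.
  by apply: cvgD; apply: cvgM => //; exact: cvg_cst.
Qed.

Lemma ccvg_normc u l : normc (u n - l) @[n --> \oo] --> (0 : R) -> ccvg u l.
Proof.
move=> H.
have D z w : z = (z - w) + w by rewrite subrK.
split.
- apply/subr_cvg0; apply: norm_cvg0; apply: (squeeze_cvgr _ (cvg_cst 0) H).
  near=> n; rewrite normr_ge0/=; apply: le_trans (norm_Re_le _).
  by rewrite [in leLHS](D (u n) l) ReD addrK.
- apply/subr_cvg0; apply: norm_cvg0; apply: (squeeze_cvgr _ (cvg_cst 0) H).
  near=> n; rewrite normr_ge0/=; apply: le_trans (norm_Im_le _).
  by rewrite [in leLHS](D (u n) l) ImD addrK.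
Unshelve. all: end_near. Qed.

Lemma csum_ccvg u l : ccvg (fun N => \sum_(0 <= k < N) u k) l -> csum u = l.
Proof.
move=> [ur ui]; rewrite /csum [RHS](_ : _ = complex.Re l +i* complex.Im l); last by case: (l).
have -> : (fun N => \sum_(0 <= k < N) complex.Re (u k)) =
    (fun N => complex.Re (\sum_(0 <= k < N) u k)) by apply/funext => N; rewrite Re_sum.
have -> : (fun N => \sum_(0 <= k < N) complex.Im (u k)) =
    (fun N => complex.Im (\sum_(0 <= k < N) u k)) by apply/funext => N; rewrite Im_sum.
by rewrite (cvg_lim _ ur)// (cvg_lim _ ui).
Qed.

(* When [c = 0] both sides vanish, whatever the behaviour of the series. *)
Lemma mul_csum_ccvg c u l :
  ccvg (fun N => c * \sum_(0 <= k < N) u k) l -> c * csum u = l.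
Proof.
have [-> H|c0 H] := eqVneq c 0.
  rewrite mul0r; apply: ccvg_unique (ccvg_cst 0) _.
  by move: H; under eq_fun do rewrite mul0r.
have := ccvgMl c^-1 H; under eq_fun do rewrite mulKf//.
by move=> /csum_ccvg ->; rewrite mulVKf.
Qed.

(** The bound does not depend on [N], so one integrable function dominates all partial sums;
    [normc_inv_subr_le] gives the same bound for the limit. *)
Lemma normc_geometric_le w N : normc w < 1 ->
  normc (\sum_(0 <= k < N) w ^+ k) <= (1 - normc w)^-1.
Proof.
move=> w1; have d0 : 0 < 1 - normc w by rewrite subr_gt0.
apply: (@le_trans _ _ (\sum_(0 <= k < N) normc w ^+ k)).
  elim: N => [|N IHN]; first by rewrite !big_geq// normc0.
  rewrite !big_nat_recr//=; apply: le_trans (complex.le_normcD _ _) _.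
  by rewrite lerD// normcX.
rewrite -[leRHS]mul1r ler_pdivlMr// mulrC big_mkord -opprB mulNr -subrX1 opprB.
by rewrite gerBl exprn_ge0 ?normc_ge0.
Qed.

Lemma normc_inv_subr_le w : normc w < 1 -> normc (1 - w)^-1 <= (1 - normc w)^-1.
Proof.
move=> w1; have d0 : 0 < 1 - normc w by rewrite subr_gt0.
have le : 1 - normc w <= normc (1 - w).
  rewrite lerBlDr; apply: le_trans (complex.le_normcD _ _).
  by rewrite subrK normc1.
by rewrite normcV lef_pV2 ?posrE// (lt_le_trans d0).
Qed.

(** The distance from the partial sum to the limit is exactly [|w|^N |1 - w|^-1]. *)
Lemma ccvg_geometric w : normc w < 1 ->
  ccvg (fun N => \sum_(0 <= k < N) w ^+ k) (1 - w)^-1.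
Proof.
move=> w1; have nw : 1 - w != 0.
  by apply/eqP => /subr0_eq w1'; move: w1; rewrite -w1' normc1 ltxx.
apply: ccvg_normc.
have -> : (fun N => normc (\sum_(0 <= k < N) w ^+ k - (1 - w)^-1)) =
    (fun N => normc w ^+ N * normc (1 - w)^-1).
  apply/funext => N; rewrite -normcX -normcM.
  rewrite -complex.normcN; congr normc.
  apply: (mulfI nw); rewrite mulrCA divff// mulr1 opprB mulrBr divff// big_mkord.
  by rewrite -[1 - w in X in _ - X]opprB mulNr -subrX1 opprK addrC subrK.
rewrite -(mul0r (normc (1 - w)^-1)); apply: cvgM; last exact: cvg_cst.
by apply: cvg_expr; rewrite ger0_norm ?normc_ge0.
Qed.

End complex_sequences.

Section complex_integral.
Context {d : measure_display} {T : measurableType d} {R : realType}.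
Implicit Types (f g : T -> R[i]).

Definition cmeasurable f :=
  measurable_fun setT (fun x => complex.Re (f x)) /\ measurable_fun setT (fun x => complex.Im (f x)).

Lemma cmeasurable_cst c : cmeasurable (fun=> c).
Proof. by split; exact: measurable_cst. Qed.

Lemma cmeasurableD f g : cmeasurable f -> cmeasurable g ->
  cmeasurable (fun x => f x + g x).
Proof.
move=> [fr fi] [gr gi]; split.
- by under eq_fun do rewrite ReD; exact: measurable_funD.
- by under eq_fun do rewrite ImD; exact: measurable_funD.
Qed.

Lemma cmeasurableM f g : cmeasurable f -> cmeasurable g ->
  cmeasurable (fun x => f x * g x).
Proof.
move=> [fr fi] [gr gi]; split.
- by under eq_fun do rewrite ReM; apply: measurable_funB; exact: measurable_funM.
- by under eq_fun do rewrite ImM; apply: measurable_funD; exact: measurable_funM.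
Qed.

Lemma cmeasurable_real (h : T -> R) : measurable_fun setT h ->
  cmeasurable (fun x => (h x)%:C).
Proof. by move=> mh; split => //=; exact: measurable_cst. Qed.

Lemma cmeasurableX f n : cmeasurable f -> cmeasurable (fun x => f x ^+ n).
Proof.
move=> mf; elim: n => [|n IHn]; first exact: (cmeasurable_cst 1).
by under eq_fun do rewrite exprS; exact: cmeasurableM.
Qed.

Lemma cmeasurable_sum (h : nat -> T -> R[i]) N : (forall k, cmeasurable (h k)) ->
  cmeasurable (fun x => \sum_(0 <= k < N) h k x).
Proof.
move=> mh; elim: N => [|N IHN].
  by under eq_fun do rewrite big_geq//; exact: (cmeasurable_cst 0).
by under eq_fun do rewrite big_nat_recr//=; exact: cmeasurableD.
Qed.

Lemma cmeasurable_lim (h : nat -> T -> R[i]) f : (forall n, cmeasurable (h n)) ->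
  (forall x, ccvg (h ^~ x) (f x)) -> cmeasurable f.
Proof.
move=> mh hf; split.
- apply: (measurable_fun_cvg (h := fun n x => complex.Re (h n x))).
  + by move=> n; case: (mh n).
  + by move=> x _; case: (hf x).
- apply: (measurable_fun_cvg (h := fun n x => complex.Im (h n x))).
  + by move=> n; case: (mh n).
  + by move=> x _; case: (hf x).
Qed.

Variable mu : {measure set T -> \bar R}.

Definition cintegrable f :=
  mu.-integrable setT (EFin \o (fun x => complex.Re (f x))) /\
  mu.-integrable setT (EFin \o (fun x => complex.Im (f x))).

Definition Cint f : R[i] :=
  (\int[mu]_x complex.Re (f x)) +i* (\int[mu]_x complex.Im (f x)).

Lemma cintegrable_le f (g : T -> R) : cmeasurable f ->
  mu.-integrable setT (EFin \o g) -> (forall x, normc (f x) <= g x) -> cintegrable f.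
Proof.
move=> [fr fi] ig fg; split.
- apply: (le_integrable _ _ _ ig) => //; first exact/measurable_EFinP.
  move=> x _; rewrite lee_fin (le_trans (norm_Re_le _))// (le_trans (fg x))//.
  exact: ler_norm.
- apply: (le_integrable _ _ _ ig) => //; first exact/measurable_EFinP.
  move=> x _; rewrite lee_fin (le_trans (norm_Im_le _))// (le_trans (fg x))//.
  exact: ler_norm.
Qed.

Lemma cintegrableD f g : cintegrable f -> cintegrable g ->
  cintegrable (fun x => f x + g x).
Proof.
move=> [fr fi] [gr gi]; split.
- apply: (eq_integrable _ _ _ _ (integrableD _ fr gr)) => // x _.
  by rewrite /= ReD.
- apply: (eq_integrable _ _ _ _ (integrableD _ fi gi)) => // x _.
  by rewrite /= ImD.
Qed.

Lemma CintD f g : cintegrable f -> cintegrable g ->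
  Cint (fun x => f x + g x) = Cint f + Cint g.
Proof.
move=> [fr fi] [gr gi]; apply: complexP; rewrite ?ReD ?ImD /= -RintegralD//.
- by apply: eq_Rintegral => x _; rewrite ReD.
- by apply: eq_Rintegral => x _; rewrite ImD.
Qed.

Lemma integrable_realZl (a : R) (h : T -> R) :
  mu.-integrable setT (EFin \o h) -> mu.-integrable setT (EFin \o (fun x => a * h x)).
Proof. by move=> ih; apply: (eq_integrable _ _ _ _ (integrableZl _ a ih)). Qed.

Lemma CintZl c f : cintegrable f ->
  cintegrable (fun x => c * f x) /\ Cint (fun x => c * f x) = c * Cint f.
Proof.
move=> [fr fi].
have Z := integrable_realZl; split.
- split.
  + apply: (eq_integrable _ _ _ _ (integrableB _ (Z (complex.Re c) _ fr) (Z (complex.Im c) _ fi))) => // x _.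
    by rewrite /= ReM.
  + apply: (eq_integrable _ _ _ _ (integrableD _ (Z (complex.Re c) _ fi) (Z (complex.Im c) _ fr))) => // x _.
    by rewrite /= ImM.
- apply: complexP; rewrite ?ReM ?ImM /= -!RintegralZl//.
  + rewrite -RintegralB; [|by []|exact: Z|exact: Z].
    by apply: eq_Rintegral => x _; rewrite ReM.
  + rewrite -RintegralD; [|by []|exact: Z|exact: Z].
    by apply: eq_Rintegral => x _; rewrite ImM.
Qed.

Lemma Cint_sum (h : nat -> T -> R[i]) N : (forall k, cintegrable (h k)) ->
  Cint (fun x => \sum_(0 <= k < N) h k x) = \sum_(0 <= k < N) Cint (h k).
Proof.
move=> ih.
have isum N' : cintegrable (fun x => \sum_(0 <= k < N') h k x).
  elim: N' => [|N' IHN]; last first.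
    by under eq_fun do rewrite big_nat_recr//=; exact: cintegrableD.
  under eq_fun do rewrite big_geq//.
  by split; exact: integrable0.
elim: N => [|N IHN].
  rewrite big_geq//; under eq_fun do rewrite big_geq//.
  by apply: complexP => /=; rewrite Rintegral_cst// mul0r.
rewrite big_nat_recr//= -IHN -CintD//.
by congr Cint; apply/funext => x; rewrite big_nat_recr.
Qed.

Lemma cvg_Rintegral_dominated (h : nat -> T -> R) (f g : T -> R) :
  (forall n, measurable_fun setT (h n)) -> (forall x, h n x @[n --> \oo] --> f x) ->
  mu.-integrable setT (EFin \o g) -> (forall n x, `|h n x| <= g x) ->
  \int[mu]_x h n x @[n --> \oo] --> \int[mu]_x f x.
Proof.
move=> mh hf ig hg.
have fg x : `|f x| <= g x.
  have hn : `|h n x| @[n --> \oo] --> `|f x| by exact: cvg_norm (hf x).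
  rewrite -(cvg_lim _ hn)//; apply: limr_le; first by apply/cvg_ex; exists `|f x|.
  by near=> n.
have mf : measurable_fun setT f by apply: (measurable_fun_cvg mh) => x _; exact: hf.
have i_f : mu.-integrable setT (EFin \o f).
  apply: (le_integrable _ _ _ ig) => //; first exact/measurable_EFinP.
  by move=> x _; rewrite lee_fin (le_trans (fg x))// ler_norm.
have := i_f => /integrable_fin_num/fineK => /(_ measurableT).
rewrite /Rintegral => fE; apply: fine_cvg; rewrite fE.
apply: (@dominated_cvg _ _ _ mu setT measurableT _ _ (EFin \o g)) => //=.
- by move=> n; apply/measurable_EFinP; exact: mh.
- by move=> x _; apply: cvg_EFin; [near=> n | exact: hf].
- by move=> n x _; rewrite lee_fin.
Unshelve. all: end_near. Qed.

Lemma ccvg_Cint_dominated (h : nat -> T -> R[i]) f (g : T -> R) :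
  (forall n, cmeasurable (h n)) -> (forall x, ccvg (h ^~ x) (f x)) ->
  mu.-integrable setT (EFin \o g) -> (forall n x, normc (h n x) <= g x) ->
  ccvg (fun n => Cint (h n)) (Cint f).
Proof.
move=> mh hf ig hg; split => /=.
- apply: (cvg_Rintegral_dominated _ _ ig).
  + by move=> n; case: (mh n).
  + by move=> x; case: (hf x).
  + by move=> n x; rewrite (le_trans (norm_Re_le _)).
- apply: (cvg_Rintegral_dominated _ _ ig).
  + by move=> n; case: (mh n).
  + by move=> x; case: (hf x).
  + by move=> n x; rewrite (le_trans (norm_Im_le _)).
Qed.

End complex_integral.

(** * Integrals of products of functions of separate variables *)

Section product_integral.
Context {d1 d2 : measure_display} {T1 : measurableType d1} {T2 : measurableType d2}.
Context {R : realType}.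
Variables (m1 : {sigma_finite_measure set T1 -> \bar R})
          (m2 : {sigma_finite_measure set T2 -> \bar R}).
Let m12 : {measure set (T1 * T2) -> \bar R} := (m1 \x m2)%E.

Lemma integrable_prod (f : T1 -> R) (g : T2 -> R) :
  m1.-integrable setT (EFin \o f) -> m2.-integrable setT (EFin \o g) ->
  m12.-integrable setT (EFin \o (fun p => f p.1 * g p.2)).
Proof.
move=> i_f ig.
have mf : measurable_fun setT f by exact/measurable_EFinP/(measurable_int _ i_f).
have mg : measurable_fun setT g by exact/measurable_EFinP/(measurable_int _ ig).
apply/integrable12ltyP.
  apply/measurable_EFinP; apply: measurable_funM.
    by apply: (measurableT_comp mf); exact: measurable_fst.
  by apply: (measurableT_comp mg); exact: measurable_snd.
have igE (x : T1) : (\int[m2]_y `|(f x * g y)%:E| =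
    `|f x|%:E * \int[m2]_y `|(g y)%:E|)%E.
  rewrite -ge0_integralZl//=; last exact/measurable_EFinP/measurableT_comp.
  by apply: eq_integral => y _; rewrite /= normrM EFinM.
rewrite /=; under eq_integral do rewrite igE.
have /integrableP[_ ifoo] := i_f; have /integrableP[_ igoo] := ig.
rewrite ge0_integralZr//=; last 2 first.
- exact/measurable_EFinP/measurableT_comp.
- exact: integral_ge0.
by apply: lte_mul_pinfty; [exact: integral_ge0 | rewrite ge0_fin_numE//; exact: integral_ge0 |].
Qed.

Lemma Rintegral_prod (f : T1 -> R) (g : T2 -> R) :
  m1.-integrable setT (EFin \o f) -> m2.-integrable setT (EFin \o g) ->
  \int[m12]_p (f p.1 * g p.2) = (\int[m1]_x f x) * (\int[m2]_y g y).
Proof.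
move=> i_f ig; have ifg := integrable_prod i_f ig.
rewrite {1}/Rintegral -integral12_prod_meas1//= /fubini_F /=.
under eq_integral => x _.
  under eq_integral do rewrite EFinM.
  rewrite integralZl//.
  have -> : (\int[m2]_y (g y)%:E)%E = (\int[m2]_y g y)%:E.
    by rewrite /Rintegral fineK//; exact: (integrable_fin_num measurableT ig).
  over.
rewrite integralZr// -[X in (X * _)%E](fineK (integrable_fin_num measurableT i_f)).
by rewrite -EFinM.
Qed.

Lemma Cint_prod (f : T1 -> R[i]) (g : T2 -> R[i]) :
  cintegrable m1 f -> cintegrable m2 g ->
  cintegrable m12 (fun p => f p.1 * g p.2) /\
  Cint m12 (fun p => f p.1 * g p.2) = Cint m1 f * Cint m2 g.
Proof.
move=> [fr fi] [gr gi]; split.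
- split.
  + apply: (eq_integrable _ _ _ _ (integrableB _ (integrable_prod fr gr) (integrable_prod fi gi))) => // x _.
    by rewrite /= ReM.
  + apply: (eq_integrable _ _ _ _ (integrableD _ (integrable_prod fr gi) (integrable_prod fi gr))) => // x _.
    by rewrite /= ImM.
- apply: complexP; rewrite ?ReM ?ImM /= -!Rintegral_prod//.
  + rewrite -RintegralB; [|by []|exact: (integrable_prod fr gr)|exact: (integrable_prod fi gi)].
    by apply: eq_Rintegral => x _; rewrite ReM.
  + rewrite -RintegralD; [|by []|exact: (integrable_prod fr gi)|exact: (integrable_prod fi gr)].
    by apply: eq_Rintegral => x _; rewrite ImM.
Qed.

End product_integral.

(** * The Gamma integral *)

Section exponential_substitution.
Context {R : realType}.
Local Notation lambda := (@lebesgue_measure R).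
Implicit Types (p c t x : R).

(** At the point [h] with [c e^h = 2 p], the tangent line gives [c e^x >= 2 p (1 + x - h)]. For
    [x >= 0] the exponent is thus at most a constant minus [p x]; for [x < 0] the term [p x] alone
    suffices. *)
Lemma expR_dominated p c : 0 < p -> 0 < c -> exists C : R,
  forall x, expR (p * x - c * expR x) <= C * expR (- p * `|x|).
Proof.
move=> p0 c0; pose h := ln (2 * p / c).
have ch : c * expR h = 2 * p.
  by rewrite lnK ?posrE ?divr_gt0 ?mulr_gt0// mulrC divfK ?gt_eqF.
exists (1 + expR (2 * p * (h - 1))) => x; rewrite mulrDl mul1r -expRD.
have [x0|x0] := leP 0 x.
  rewrite ger0_norm//; apply: (@le_trans _ _ (expR (2 * p * (h - 1) + - p * x))).
    rewrite ler_expR.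
    have : c * (expR h * (1 + (x - h))) <= c * expR x.
      rewrite ler_wpM2l ?(ltW c0)// -[X in _ <= expR X](subrK h) expRD [leRHS]mulrC.
      by rewrite ler_wpM2l ?expR_ge0 ?expR_ge1Dx.
    by rewrite mulrA ch; nra.
  by rewrite lerDr expR_ge0.
rewrite ltr0_norm//; apply: (@le_trans _ _ (expR (- p * - x))).
  by rewrite ler_expR mulrNN gerBl mulr_ge0 ?expR_ge0 ?(ltW c0).
by rewrite lerDl expR_ge0.
Qed.

(** By symmetry the integral is twice that over the half-line, where the integrand is [p^-1] times
    the density of the exponential law. *)
Lemma integrable_expRN_norm p : 0 < p ->
  lambda.-integrable setT (EFin \o (fun x => expR (- p * `|x|))).
Proof.
move=> p0.
have cf : continuous (fun x => expR (- p * `|x|)).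
  move=> x; apply: continuous_comp; last exact: continuous_expR.
  by apply: continuousM; [exact: cvg_cst | exact: norm_continuous].
apply/integrableP; split.
  by apply/measurable_EFinP; exact: continuous_measurable_fun.
under eq_integral do rewrite /= ger0_norm ?expR_ge0//.
rewrite ge0_symfun_integralT//=; last by move=> x /=; rewrite normrN.
have le : (\int[lambda]_(x in [set x | (0 <= x)%R]) (expR (- p * `|x|))%:E <=
    \int[lambda]_x (p^-1 * exponential_pdf p x)%:E)%E.
  rewrite integral_mkcond; apply: ge0_le_integral => //.
  - by move=> x _; apply: erestrict_ge0 => y _; rewrite lee_fin expR_ge0.
  - apply/(measurable_restrictT _ _).1.
      by rewrite -set_itvcy; exact: measurable_itv.
    by apply/measurable_funTS/measurable_EFinP; exact: continuous_measurable_fun.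
  - by apply/measurable_EFinP/measurable_funM => //; exact: measurable_exponential_pdf.
  - move=> x _; rewrite patchE; case: ifPn => [|_].
      rewrite inE/= => x0; rewrite exponential_pdfE// mulrA mulVf ?gt_eqF// mul1r.
      by rewrite ger0_norm.
    by rewrite lee_fin mulr_ge0 ?invr_ge0 ?exponential_pdf_ge0 ?(ltW p0).
rewrite (@le_lt_trans _ _ (2 * \int[lambda]_x (p^-1 * exponential_pdf p x)%:E)%E)//.
  by rewrite lee_wpmul2l.
under eq_integral do rewrite EFinM.
rewrite ge0_integralZl//=; last 3 first.
- by apply/measurable_EFinP; exact: measurable_exponential_pdf.
- by move=> x _; rewrite lee_fin exponential_pdf_ge0 ?(ltW p0).
- by rewrite lee_fin invr_ge0 ltW.
by rewrite integral_exponential_pdf// mule1 -EFinM ltry.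
Qed.

Lemma continuous_gexp p c : continuous (fun x => expR (p * x - c * expR x)).
Proof.
move=> x; apply: continuous_comp; last exact: continuous_expR.
apply: continuousB; apply: continuousM; try exact: cvg_cst.
- exact: cvg_id.
- exact: continuous_expR.
Qed.

Lemma integrable_gexp p c : 0 < p -> 0 < c ->
  lambda.-integrable setT (EFin \o (fun x => expR (p * x - c * expR x))).
Proof.
move=> p0 c0; have [C hC] := expR_dominated p0 c0.
have := integrableZl measurableT C (integrable_expRN_norm p0).
apply: le_integrable => //.
- apply/measurable_EFinP; apply: continuous_measurable_fun; exact: continuous_gexp.
- move=> x _; rewrite lee_fin ger0_norm ?expR_ge0// (le_trans (hC x))//.
  exact: ler_norm.
Qed.

Lemma exists_norm_lt_nat x : exists n : nat, `|x| < n%:R.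
Proof.
have [n _ xn] := nbhs_infty_gtr `|x|.
by exists n; exact: (xn n (leqnn n)).
Qed.

(** Substitution is applied on [[- n, n]], whose image under [F] is [B n]. Both families of
    intervals increase to the full domains, so monotone convergence passes to the limit. *)
Lemma ge0_integral_exp_substitution c (G : R -> R) : 0 < c ->
  {in `]0, +oo[%R, continuous G} -> (forall x, 0 < x -> 0 <= G x) ->
  (\int[lambda]_(x in `]0%R, +oo[) (G x)%:E =
   \int[lambda]_x (G (c * expR x) * (c * expR x))%:E)%E.
Proof.
move=> c0 cG G0; pose F x := c * expR x.
have F0 x : 0 < F x by rewrite mulr_gt0 ?expR_gt0.
have dF x : is_derive x 1 F (F x).
  exact: (is_deriveZ c (is_derive_expR x)).
have F'E : F^`()%classic = F.
  by apply/funext => x; rewrite derive1E derive_val.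
have cF : continuous F.
  by move=> x; apply: continuousM; [exact: cvg_cst | exact: continuous_expR].
pose A n := `[- n%:R, n%:R]%classic : set R.
pose B n := `[F (- n%:R), F n%:R]%classic : set R.
have incF : {homo F : x y / x < y} by move=> x y xy; rewrite ltr_pM2l ?ltr_expR.
have incF' : {homo F : x y / x <= y} by move=> x y xy; rewrite ler_pM2l ?ler_expR.
have AB n : (\int[lambda]_(x in B n) (G x)%:E =
    \int[lambda]_(x in A n) (G (F x) * F x)%:E)%E.
  rewrite /A /B (@integration_by_substitution_increasing _ F G (- n%:R) n%:R)//; first 1 last.
  - by rewrite (@le_trans _ _ 0)// oppr_le0.
  - by move=> x y _ _; exact: incF.
  - by rewrite F'E => x _; exact: cF.
  - by rewrite F'E; apply/cvg_ex; exists (F (- n%:R)); apply: cvg_at_right_filter; exact: cF.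
  - by rewrite F'E; apply/cvg_ex; exists (F n%:R); apply: cvg_at_left_filter; exact: cF.
  - split; [by move=> x _; exact: ex_derive |
      by apply: cvg_at_right_filter; exact: cF | by apply: cvg_at_left_filter; exact: cF].
  - apply: continuous_in_subspaceT => x; rewrite inE/= in_itv/= => /andP[Fx _].
    by apply: cG; rewrite in_itv/= andbT (lt_le_trans _ Fx).
  - by apply: eq_integral => x _; rewrite F'E.
have UA : \bigcup_n A n = setT.
  apply/seteqP; split => // x _; have [n xn] := exists_norm_lt_nat x.
  by exists n => //; rewrite /A /= in_itv/= -ler_norml ltW.
have UB : \bigcup_n B n = `]0, +oo[%classic.
  apply/seteqP; split => [x [n _]|x] /=; rewrite /B /= !in_itv/= ?andbT.
    by move=> /andP[Fx _]; rewrite (lt_le_trans _ Fx).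
  move=> x0; have xc0 : 0 < x / c by rewrite divr_gt0.
  have [n yn] := exists_norm_lt_nat (ln (x / c)); exists n => //.
  have xE : x = F (ln (x / c)) by rewrite /F lnK ?posrE// mulrC divfK ?gt_eqF.
  rewrite /B /= in_itv/= xE.
  by apply/andP; split; apply: incF'; move/ltW: yn; rewrite ler_norml => /andP[].
have ndA : nondecreasing_seq A.
  move=> m n mn; apply/subsetPset => x; rewrite /A /= !in_itv/= -!ler_norml => /le_trans; apply.
  by rewrite ler_nat.
have ndB : nondecreasing_seq B.
  move=> m n mn; apply/subsetPset => x; rewrite /B /= !in_itv/= => /andP[Fx xF].
  apply/andP; split.
    by apply: le_trans Fx; apply: incF'; rewrite lerN2 ler_nat.
  by apply: (le_trans xF); apply: incF'; rewrite ler_nat.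
have mG : measurable_fun (`]0, +oo[%classic : set R) G.
  apply: open_continuous_measurable_fun => //.
  by move=> x; rewrite inE/=; exact: cG.
have cGF : continuous (fun x => G (F x) * F x).
  move=> x; apply: continuousM; last exact: cF.
  by apply: continuous_comp; [exact: cF | apply: cG; rewrite in_itv/= F0].
have limB : (\int[lambda]_(x in B n) (G x)%:E @[n --> \oo] -->
    \int[lambda]_(x in \bigcup_n B n) (G x)%:E)%E.
  apply: ge0_nondecreasing_set_cvg_integral => //.
  - by move=> n; exact: measurable_itv.
  - move=> n; apply/measurable_EFinP; apply: measurable_funS mG => //.
    by rewrite -UB => x Bx; exists n.
  - move=> n x Bx; rewrite lee_fin G0//.
    have : (\bigcup_n B n) x by exists n.
    by rewrite UB /= in_itv/= andbT.
have limA : (\int[lambda]_(x in A n) (G (F x) * F x)%:E @[n --> \oo] -->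
    \int[lambda]_(x in \bigcup_n A n) (G (F x) * F x)%:E)%E.
  apply: ge0_nondecreasing_set_cvg_integral => //.
  - by move=> n; exact: measurable_itv.
  - move=> n; apply/measurable_EFinP; apply: measurable_funTS.
    exact: continuous_measurable_fun.
  - by move=> n x _; rewrite lee_fin mulr_ge0 ?G0 ?(ltW (F0 x)).
have AB' : (fun n => \int[lambda]_(x in B n) (G x)%:E)%E =
    (fun n => \int[lambda]_(x in A n) (G (F x) * F x)%:E)%E by exact/funext.
by rewrite -UB -[in RHS]UA; rewrite AB' in limB; exact: cvg_unique limB limA.
Qed.

(** [G + W] and [W] are nonnegative, so the previous lemma applies to both, and subtraction gives
    the formula for the signed function [G]. *)
Lemma Rintegral_exp_substitution c (G W : R -> R) : 0 < c ->
  {in `]0, +oo[%R, continuous G} -> {in `]0, +oo[%R, continuous W} ->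
  (forall x, 0 < x -> `|G x| <= W x) ->
  lambda.-integrable setT (EFin \o (fun x => W (c * expR x) * (c * expR x))) ->
  \int[lambda]_(x in `]0, +oo[) G x = \int[lambda]_x (G (c * expR x) * (c * expR x)).
Proof.
move=> c0 cG cW GW iW.
have F0 x : 0 < c * expR x by rewrite mulr_gt0 ?expR_gt0.
have cF : continuous (fun x : R => c * expR x).
  by move=> x; apply: continuousM; [exact: cvg_cst | exact: continuous_expR].
have W0 x : 0 < x -> 0 <= W x by move=> x0; rewrite (le_trans _ (GW x x0)).
have m1 (H : R -> R) : {in `]0, +oo[%R, continuous H} ->
    measurable_fun (`]0, +oo[%classic : set R) H.
  move=> cH; apply: open_continuous_measurable_fun => //.
  by move=> x; rewrite inE/=; exact: cH.
have m2 (H : R -> R) : {in `]0, +oo[%R, continuous H} ->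
    measurable_fun setT (fun x => H (c * expR x) * (c * expR x)).
  move=> cH; apply: continuous_measurable_fun.
  have : continuous (fun x : R => H (c * expR x) * (c * expR x)); last by exact.
  move=> x; apply: (@continuousM _ _ (fun x : R => H (c * expR x)) (fun x : R => c * expR x)); last exact: cF.
  by apply: continuous_comp; [exact: cF | apply: cH; rewrite in_itv/= F0].
have iW0 : lambda.-integrable `]0%R, +oo[ (EFin \o W).
  apply/integrableP; split; first by apply/measurable_EFinP; exact: m1.
  have -> : (\int[lambda]_(x in `]0%R, +oo[) `|(EFin \o W) x| =
      \int[lambda]_(x in `]0%R, +oo[) (W x)%:E)%E.
    by apply: eq_integral => x; rewrite inE/= in_itv/= andbT => x0; rewrite /= ger0_norm ?W0.
  rewrite (ge0_integral_exp_substitution c0 cW W0).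
  exact: (integrable_lty measurableT iW).
have iG0 : lambda.-integrable `]0%R, +oo[ (EFin \o G).
  apply: le_integrable iW0 => //; first by apply/measurable_EFinP; exact: m1.
  move=> x /=; rewrite in_itv/= andbT => x0.
  by rewrite lee_fin (le_trans (GW x x0))// ler_norm.
have iG : lambda.-integrable setT (EFin \o (fun x => G (c * expR x) * (c * expR x))).
  apply: le_integrable iW => //; first by apply/measurable_EFinP; exact: m2.
  move=> x _ /=; rewrite lee_fin !normrM ler_wpM2r//.
  by rewrite (le_trans (GW _ (F0 x)))// ler_norm.
have sub (H : R -> R) : {in `]0, +oo[%R, continuous H} -> (forall x, 0 < x -> 0 <= H x) ->
    \int[lambda]_(x in `]0, +oo[) H x = \int[lambda]_x (H (c * expR x) * (c * expR x)).
  by move=> cH H0; rewrite /Rintegral (ge0_integral_exp_substitution c0 cH H0).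
have cGW : {in `]0, +oo[%R, continuous (fun x => G x + W x)}.
  by move=> x x0; apply: continuousD; [exact: cG | exact: cW].
have GW0 x : 0 < x -> 0 <= G x + W x.
  by move=> x0; have := GW x x0; rewrite ler_norml => /andP[]; lra.
have := sub _ cGW GW0; rewrite RintegralD// (sub _ cW W0).
under [X in _ = X -> _]eq_Rintegral do rewrite mulrDl.
by rewrite RintegralD// => /addIr.
Qed.

End exponential_substitution.

Section gamma_scaling.
Context {R : realType}.
Local Notation lambda := (@lebesgue_measure R).
Implicit Types (c t x : R) (s : R[i]).

Definition cis x : R[i] := cos x +i* sin x.

Lemma cisD x y : cis (x + y) = cis x * cis y.
Proof. by apply: complexP; rewrite ?ReM ?ImM /= ?cosD ?sinD// addrC. Qed.

Lemma cis0 : cis 0 = 1.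
Proof. by rewrite /cis cos0 sin0. Qed.

Lemma normc_cis x : normc (cis x) = 1.
Proof. by rewrite /= cos2Dsin2 sqrtr1. Qed.

(* The integrand [x^(s-1) e^(-c x)] of Gamma after the substitution [x = e^eta],
   Jacobian included. *)
Definition gamma_kernel s c x : R[i] :=
  (expR (complex.Re s * x - c * expR x))%:C * cis (complex.Im s * x).

Lemma normc_gamma_kernel s c x :
  normc (gamma_kernel s c x) = expR (complex.Re s * x - c * expR x).
Proof.
by rewrite normcM normc_cis mulr1 normc_real ger0_norm ?expR_ge0.
Qed.

Lemma cmeasurable_cis {d} {T : measurableType d} (h : T -> R) :
  measurable_fun setT h -> cmeasurable (fun y : T => cis (h y)).
Proof.
move=> mh; split => /=.
- by apply: measurableT_comp mh; exact: continuous_measurable_fun (@continuous_cos R).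
- by apply: measurableT_comp mh; exact: continuous_measurable_fun (@continuous_sin R).
Qed.

Lemma cmeasurable_gamma_kernel s c : cmeasurable (gamma_kernel s c).
Proof.
apply: cmeasurableM.
  by apply: cmeasurable_real; apply: continuous_measurable_fun; exact: continuous_gexp.
by apply: cmeasurable_cis; apply: measurable_funM => //; exact: measurable_cst.
Qed.

Lemma cintegrable_gamma_kernel s c : 0 < complex.Re s -> 0 < c ->
  cintegrable lambda (gamma_kernel s c).
Proof.
move=> s0 c0; apply: (cintegrable_le _ (integrable_gexp s0 c0)).
  exact: cmeasurable_gamma_kernel.
by move=> x; rewrite normc_gamma_kernel.
Qed.

(** [trig] stands for [cos] and [sin], so one statement serves the real and imaginary parts of
    Gamma. The Jacobian [c e^x] raises the exponent [sig - 1] to [sig], and the logarithm of [c e^x]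
    splits as [ln c + x]. *)
Lemma Rintegral_gamma (sig t c : R) (trig : R -> R) : 0 < sig -> 0 < c ->
  continuous trig -> (forall x, `|trig x| <= 1) ->
  \int[lambda]_(x in `]0, +oo[) (x `^ (sig - 1) * expR (- x) * trig (t * ln x)) =
  \int[lambda]_x (c `^ sig * expR (sig * x - c * expR x) * trig (t * ln c + t * x)).
Proof.
move=> sig0 c0 ctrig trig1.
have powE (b y : R) : 0 < y -> y `^ b = expR (b * ln y).
  by move=> y0; rewrite /powR gt_eqF.
have cpow : {in `]0, +oo[%R, continuous (fun x : R => x `^ (sig - 1) * expR (- x))}.
  move=> x; rewrite in_itv/= andbT => x0.
  apply: (@continuousM _ _ (fun x : R => x `^ (sig - 1)) (fun x : R => expR (- x))); last first.
    by apply: continuous_comp; [exact: continuousN | exact: continuous_expR].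
  (* The power is the exponential of a logarithm only for positive arguments, so continuity is
     transferred on a neighbourhood of [x]. *)
  have : {for x, continuous (fun x : R => expR ((sig - 1) * ln x))}.
    apply: continuous_comp; last exact: continuous_expR.
    apply: (@continuousM _ _ (fun=> sig - 1) (@ln R)); first exact: cvg_cst.
    exact: continuous_ln.
  rewrite /prop_for /continuous_at powE// => H; apply: cvg_trans H.
  apply: near_eq_cvg; near=> y; rewrite powE//.
  by near: y; exact: lt_nbhsr.
have FE x : c * expR x = expR (ln c + x) by rewrite expRD lnK.
have WE x : (c * expR x) `^ (sig - 1) * expR (- (c * expR x)) * (c * expR x) =
    c `^ sig * expR (sig * x - c * expR x).
  have F0 : 0 < c * expR x by rewrite mulr_gt0 ?expR_gt0.
  rewrite !powE// FE expRK.
  rewrite -!expRD; congr expR; rewrite -FE; ring.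
rewrite (@Rintegral_exp_substitution _ c _ (fun x => x `^ (sig - 1) * expR (- x)))//.
- apply: eq_Rintegral => x _; rewrite -WE {3}FE expRK mulrDr.
  by rewrite mulrAC.
- move=> x x0.
  apply: (@continuousM _ _ (fun x : R => x `^ (sig - 1) * expR (- x)) (fun x => trig (t * ln x))).
    exact: cpow.
  apply: continuous_comp; last exact: ctrig.
  apply: (@continuousM _ _ (fun=> t) (@ln R)); first exact: cvg_cst.
  by move: x0; rewrite in_itv/= andbT; exact: continuous_ln.
- move=> x x0; rewrite normrM -[leRHS]mulr1 ler_pM//.
  by rewrite ger0_norm// mulr_ge0 ?expR_ge0 ?powR_ge0.
- apply: (eq_integrable _ _ _ _ (integrableZl _ (c `^ sig) (integrable_gexp sig0 c0))) => //.
  by move=> x _; rewrite /= WE.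
Unshelve. all: end_near. Qed.

(** The substitution with scale [c] brings out the factor [c^sig e^(i t ln c) = c^s], which
    [cpowN c s] cancels. *)
Lemma cGamma_cpowN s c : 0 < complex.Re s -> 0 < c ->
  cGamma s * cpowN c s = Cint lambda (gamma_kernel s c).
Proof.
case: s => sig t /= sig0 c0.
have GE : cGamma (sig +i* t) =
    (c `^ sig)%:C * cis (t * ln c) * Cint lambda (gamma_kernel (sig +i* t) c).
  have [_ <-] := CintZl ((c `^ sig)%:C * cis (t * ln c))
    (cintegrable_gamma_kernel (s := sig +i* t) sig0 c0).
  rewrite /cGamma /Cint; congr (_ +i* _); rewrite [LHS]/= (Rintegral_gamma _ sig0 c0)//.
  - by apply: eq_Rintegral => x _; rewrite !(ReM, ImM) /= cosD; ring.
  - exact: continuous_cos.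
  - exact: norm_cos_le1.
  - by apply: eq_Rintegral => x _; rewrite !(ReM, ImM) /= sinD; ring.
  - exact: continuous_sin.
  - exact: norm_sin_le1.
have PE : cpowN c (sig +i* t) = (c `^ (- sig))%:C * cis (- (t * ln c)).
  by apply: complexP; rewrite ?(ReM, ImM) /= mulNr mul0r ?subr0 ?addr0.
rewrite GE PE mulrC !mulrA -[X in X * _]mulrA mulrACA.
rewrite -cisD addrC subrr cis0 mulr1 -rmorphM/= powRN mulVf ?mul1r//.
by rewrite powR_eq0 negb_and gt_eqF.
Qed.

End gamma_scaling.

(** * The integral representation *)

Section integral_representation.
Context {R : realType}.
Local Notation lambda := (@lebesgue_measure R).
Local Notation lambda2 := (lambda \x lambda)%E.
Implicit Types (c x y : R) (s z w : R[i]).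

(** From [|w| e^(c y) <= 1] and [e^(c y) >= 1 + c y] follows [(1 - |w|) e^(c y) >= c y]. A small [c]
    keeps the loss [e^(c y)] below the decay available in the Gamma kernels. *)
Lemma le_inv_1subr_expR c y w : 0 < c -> c <= 1 -> 0 < y -> normc w <= expR (- y) ->
  normc w < 1 /\ (1 - normc w)^-1 <= expR (c * y) / (c * y).
Proof.
move=> c0 c1 y0 wy; have cy0 : 0 < c * y by rewrite mulr_gt0.
have w1 : normc w < 1 by rewrite (le_lt_trans wy)// -[ltRHS]expR0 ltr_expR oppr_lt0.
split => //; rewrite -[leRHS]invrK lef_pV2 ?posrE ?invr_gt0 ?divr_gt0 ?expR_gt0 ?subr_gt0//.
rewrite invf_div ler_pdivrMr ?expR_gt0//.
have e1 : normc w * expR (c * y) <= 1.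
  rewrite (@le_trans _ _ (expR (- y) * expR (c * y))) ?ler_wpM2r ?expR_ge0//.
  by rewrite -expRD -[leRHS]expR0 ler_expR; nra.
by have := expR_ge1Dx (c * y); rewrite mulrBl mul1r; lra.
Qed.

(** This makes a series over integer shifts a geometric series under the integral. *)
Lemma gamma_kernel_addn s c x n :
  gamma_kernel s (c + n%:R) x = gamma_kernel s c x * (expR (- expR x))%:C ^+ n.
Proof.
rewrite /gamma_kernel mulrAC -rmorphXn/= -expRM_natl -rmorphM/= -expRD.
by congr ((expR _)%:C * _); rewrite mulrDl; ring.
Qed.

(** The ratio of both geometric series: [y] is [e^theta] for the inner sum and [e^eta + e^theta] for
    the outer one. *)
Definition lerch_ratio z y : R[i] := z * (expR (- y))%:C.

Lemma normc_lerch_ratio z y : normc z <= 1 -> normc (lerch_ratio z y) <= expR (- y).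
Proof.
move=> z1; rewrite normcM normc_real ger0_norm ?expR_ge0//.
by rewrite ler_piMl ?expR_ge0.
Qed.

Lemma cmeasurable_lerch_ratio {d} {T : measurableType d} z (h : T -> R) :
  measurable_fun setT h -> cmeasurable (fun t : T => lerch_ratio z (h t)).
Proof.
move=> mh; apply: cmeasurableM; first exact: cmeasurable_cst.
apply: cmeasurable_real; apply: (measurableT_comp (f := expR)); last exact: measurableT_comp.
exact: measurable_expR.
Qed.

Definition inner_kernel s c z x : R[i] :=
  gamma_kernel s c x * (1 - lerch_ratio z (expR x))^-1.

(** Each term is a Gamma integral with shift [c + n]. Summing the geometric series under the
    integral by dominated convergence gives [inner_kernel]. *)
Lemma inner_csum s c z : 1 < complex.Re s -> 1 < c -> normc z <= 1 ->
  [/\ @cmeasurable _ (measurableTypeR R) R (inner_kernel s c z),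
      cintegrable lambda (inner_kernel s c z) &
      cGamma s * csum (fun n => z ^+ n * cpowN (c + n%:R) s) =
      Cint lambda (inner_kernel s c z)].
Proof.
move=> s1 c1 z1; have s0 : 0 < complex.Re s by lra. have c0 : 0 < c by lra.
pose h N x := gamma_kernel s c x * \sum_(0 <= k < N) lerch_ratio z (expR x) ^+ k.
(* Bounding [1 / (1 - e^(- y))] by [e^y / y] at [y = e^x] costs one power of [y] and one unit of
   [c]; both remaining coefficients are positive. *)
pose g x := expR ((complex.Re s - 1) * x - (c - 1) * expR x).
have q x := le_inv_1subr_expR ltr01 (lexx 1) (expR_gt0 x) (normc_lerch_ratio (expR x) z1).
have mh N : @cmeasurable _ (measurableTypeR R) R (h N).
  apply: cmeasurableM; first exact: cmeasurable_gamma_kernel.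
  apply: cmeasurable_sum => k; apply: cmeasurableX; apply: cmeasurable_lerch_ratio.
  exact: measurable_expR.
have hf x : ccvg (h ^~ x) (inner_kernel s c z x).
  by apply: ccvgMl; apply: ccvg_geometric; case: (q x).
have mf := cmeasurable_lim mh hf.
have ig : lambda.-integrable setT (EFin \o g) by apply: integrable_gexp; lra.
have gE x : expR (complex.Re s * x - c * expR x) * (expR (1 * expR x) / (1 * expR x)) = g x.
  by rewrite !mul1r -expRN -!expRD; congr expR; ring.
have hg N x : normc (h N x) <= g x.
  have [w1 wle] := q x.
  rewrite normcM normc_gamma_kernel -gE ler_wpM2l ?expR_ge0//.
  by rewrite (le_trans (normc_geometric_le N w1)).
have fg x : normc (inner_kernel s c z x) <= g x.
  have [w1 wle] := q x.
  rewrite normcM normc_gamma_kernel -gE ler_wpM2l ?expR_ge0//.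
  by rewrite (le_trans (normc_inv_subr_le w1)).
split; [exact: mf | exact: (cintegrable_le mf ig fg) |].
apply: mul_csum_ccvg.
suff E N : cGamma s * \sum_(0 <= k < N) (z ^+ k * cpowN (c + k%:R) s) = Cint lambda (h N).
  by under eq_fun do rewrite E; exact: ccvg_Cint_dominated mh hf ig hg.
pose t k x := z ^+ k * gamma_kernel s (c + k%:R) x.
have ck k : 0 < c + k%:R by rewrite ltr_pwDl.
have tE k := CintZl (z ^+ k) (cintegrable_gamma_kernel s0 (ck k)).
rewrite mulr_sumr (_ : h N = fun x => \sum_(0 <= k < N) t k x).
  rewrite Cint_sum; last by move=> k; case: (tE k).
  apply: eq_bigr => k _; have [_ ->] := tE k.
  by rewrite -cGamma_cpowN// mulrCA.
apply/funext => x; rewrite /h mulr_sumr; apply: eq_bigr => k _.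
by rewrite /t gamma_kernel_addn /lerch_ratio exprMn mulrCA.
Qed.

Variables (a : R) (z1 z2 s1 s2 : R[i]).
Hypotheses (a0 : 0 < a) (a1 : a <= 1) (z1_le1 : normc z1 <= 1) (z2_le1 : normc z2 <= 1).
Hypotheses (s1_gt0 : 0 < complex.Re s1) (s2_gt1 : 1 < complex.Re s2)
  (s12_gt2 : 2 < complex.Re s1 + complex.Re s2).

(** The second shift is [1 + a] because the inner sum starts at [n = 1]. The outer index shifts both
    Gamma kernels, whence a ratio in [e^eta + e^theta]. *)
Definition lerch_kernel (p : R * R) : R[i] :=
  gamma_kernel s1 a p.1 * inner_kernel s2 (1 + a) z2 p.2 *
  (1 - lerch_ratio z1 (expR p.1 + expR p.2))^-1.

(** The three conditions on [s1] and [s2] say that the interval from [max 0 (2 - Re s2)] to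
    [min 1 (Re s1)] is nonempty. The witness is its midpoint in each of the four cases. *)
Lemma interpolation_exponent : exists al : R,
  [/\ 0 <= al, al <= 1, al < complex.Re s1 & 2 - complex.Re s2 < al].
Proof.
set x := complex.Re s1; set y := complex.Re s2.
have [x1|x1] := leP x 1; have [y2|y2] := leP y 2.
- by exists ((x + 2 - y) / 2); split; move: s1_gt0 s2_gt1 s12_gt2; rewrite -/x -/y; lra.
- by exists (x / 2); split; move: s1_gt0 s2_gt1 s12_gt2; rewrite -/x -/y; lra.
- by exists ((3 - y) / 2); split; move: s1_gt0 s2_gt1 s12_gt2; rewrite -/x -/y; lra.
- by exists 2^-1; split; move: s1_gt0 s2_gt1 s12_gt2; rewrite -/x -/y; lra.
Qed.

(** A weighted mean of [x] and [y] is at most their maximum, and the larger exponential is at most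
    the sum. *)
Lemma expR_interpolation (al x y : R) : 0 <= al -> al <= 1 ->
  expR (al * x + (1 - al) * y) <= expR x + expR y.
Proof.
move=> al0 al1; have [xy|yx] := leP x y.
  by rewrite (@le_trans _ _ (expR y)) ?lerDr ?expR_ge0// ler_expR; nra.
by rewrite (@le_trans _ _ (expR x)) ?lerDl ?expR_ge0// ler_expR; nra.
Qed.

(* Dominates the kernel by a product of Gamma integrands:
   [1 / (X + Y) <= X^(- al) Y^(al - 1)] and [1 / (1 - e^(- y)) <= e^(c y) / (c y)]
   with [c = a / 2]. *)
Definition lerch_bound (al : R) (p : R * R) : R := (a / 2) ^- 2 *
  (expR ((complex.Re s1 - al) * p.1 - a / 2 * expR p.1) *
   expR ((complex.Re s2 - 2 + al) * p.2 - 1 * expR p.2)).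

(** The free factor [v] covers the partial sums of the outer series as well as their limit. The
    remaining decay is [a - a/2 = a/2] in [e^eta] and [1 + a - a/2 - a/2 = 1] in [e^theta]. *)
Lemma lerch_boundP (al : R) (p : R * R) (v : R) : 0 <= al -> al <= 1 ->
  v <= (1 - normc (lerch_ratio z1 (expR p.1 + expR p.2)))^-1 ->
  normc (gamma_kernel s1 a p.1 * inner_kernel s2 (1 + a) z2 p.2) * v <= lerch_bound al p.
Proof.
move=> al0 al1 vle; case: p vle => x y /= vle.
have c0 : 0 < a / 2 by rewrite divr_gt0.
have c1 : a / 2 <= 1 by move: a1; lra.
have X0 : 0 < expR x + expR y by rewrite addr_gt0 ?expR_gt0.
have [w1 wle] := le_inv_1subr_expR c0 c1 X0 (normc_lerch_ratio _ z1_le1).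
have [u1 ule] := le_inv_1subr_expR c0 c1 (expR_gt0 y) (normc_lerch_ratio _ z2_le1).
rewrite normcM normc_gamma_kernel.
rewrite normcM normc_gamma_kernel.
have {}vle : v <= (a / 2)^-1 * expR (a / 2 * (expR x + expR y) - (al * x + (1 - al) * y)).
  rewrite (le_trans vle)// (le_trans wle)// invfM mulrCA ler_wpM2l ?invr_ge0 ?(ltW c0)//.
  rewrite expRD expRN ler_wpM2l ?expR_ge0// lef_pV2 ?posrE ?expR_gt0//.
  exact: expR_interpolation.
have {}ule : normc (1 - lerch_ratio z2 (expR y))^-1 <= (a / 2)^-1 * expR (a / 2 * expR y - y).
  rewrite (le_trans (normc_inv_subr_le u1))// (le_trans ule)//.
  by rewrite invfM mulrCA -expRN -expRD.
have N0 : 0 <= normc (1 - lerch_ratio z2 (expR y))^-1 by exact: normc_ge0.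
rewrite (@le_trans _ _ (expR (complex.Re s1 * x - a * expR x) *
  (expR (complex.Re s2 * y - (1 + a) * expR y) * ((a / 2)^-1 * expR (a / 2 * expR y - y))) *
  ((a / 2)^-1 * expR (a / 2 * (expR x + expR y) - (al * x + (1 - al) * y)))))//.
  rewrite (@le_trans _ _ (expR (complex.Re s1 * x - a * expR x) *
    (expR (complex.Re s2 * y - (1 + a) * expR y) * normc (1 - lerch_ratio z2 (expR y))^-1) *
    ((a / 2)^-1 * expR (a / 2 * (expR x + expR y) - (al * x + (1 - al) * y)))))//.
    by rewrite ler_wpM2l// !mulr_ge0 ?expR_ge0.
  rewrite ler_wpM2r ?mulr_ge0 ?invr_ge0 ?expR_ge0 ?(ltW c0)//.
  by rewrite ler_wpM2l ?expR_ge0// ler_wpM2l ?expR_ge0.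
rewrite /lerch_bound /= -exprVn expr2 le_eqVlt; apply/orP; left; apply/eqP.
rewrite (_ : forall A B C D E : R, A * (B * (C * D)) * (C * E) = C * C * (A * B * D * E)); last first.
  by move=> *; ring.
by congr (_ * _); rewrite -!expRD; congr expR; field.
Qed.

(** The inner sum of index [k] is an integral with shift [1 + a + k]. Its product with the Gamma
    integral of shift [a + k] is an integral over the plane, and the outer geometric series is then
    summed by dominated convergence. *)
Lemma lerch_representation :
  cintegrable lambda2 lerch_kernel /\
  cGamma s1 * cGamma s2 * Phi2 s1 s2 a z1 z2 = Cint lambda2 lerch_kernel.
Proof.
have [al [al0 al1 als1 als2]] := interpolation_exponent.
pose w (p : R * R) := lerch_ratio z1 (expR p.1 + expR p.2).
pose D (p : R * R) := gamma_kernel s1 a p.1 * inner_kernel s2 (1 + a) z2 p.2.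
pose h N p := D p * \sum_(0 <= k < N) w p ^+ k.
have c1 : 1 < 1 + a by rewrite ltrDl.
have [mI _ _] := @inner_csum s2 (1 + a) z2 s2_gt1 c1 z2_le1.
have w1 p : normc (w p) < 1.
  rewrite (le_lt_trans (normc_lerch_ratio _ z1_le1))// -[ltRHS]expR0 ltr_expR oppr_lt0.
  by rewrite addr_gt0 ?expR_gt0.
have mcomp1 (f : R -> R[i]) : @cmeasurable _ (measurableTypeR R) R f ->
    @cmeasurable _ (measurableTypeR R * measurableTypeR R)%type R (fun p => f p.1).
  by move=> [fr fi]; split; [apply: measurableT_comp fr _|apply: measurableT_comp fi _].
have mcomp2 (f : R -> R[i]) : @cmeasurable _ (measurableTypeR R) R f ->
    @cmeasurable _ (measurableTypeR R * measurableTypeR R)%type R (fun p => f p.2).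
  by move=> [fr fi]; split; [apply: measurableT_comp fr _|apply: measurableT_comp fi _].
have mh N : @cmeasurable _ (measurableTypeR R * measurableTypeR R)%type R (h N).
  apply: cmeasurableM.
    apply: cmeasurableM; last exact: mcomp2 mI.
    by apply: (mcomp1 (gamma_kernel s1 a)); exact: cmeasurable_gamma_kernel.
  apply: cmeasurable_sum => k; apply: cmeasurableX; apply: cmeasurable_lerch_ratio.
  by apply: measurable_funD; (apply: measurableT_comp; first exact: measurable_expR).
have hf p : ccvg (h ^~ p) (lerch_kernel p).
  by apply: ccvgMl; exact: ccvg_geometric.
have mf := cmeasurable_lim mh hf.
have ig : lambda2.-integrable setT (EFin \o lerch_bound al).
  have e1 : 0 < complex.Re s1 - al by rewrite subr_gt0.
  have e2 : 0 < complex.Re s2 - 2 + al by lra.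
  have a2 : 0 < a / 2 by rewrite divr_gt0.
  have := integrable_prod (integrable_gexp e1 a2) (integrable_gexp e2 ltr01).
  move=> /(integrableZl measurableT ((a / 2) ^- 2)) H.
  exact: (eq_integrable _ _ _ _ H).
have hg N p : normc (h N p) <= lerch_bound al p.
  rewrite /h normcM; apply: lerch_boundP => //.
  exact: normc_geometric_le.
have fg p : normc (lerch_kernel p) <= lerch_bound al p.
  rewrite /lerch_kernel normcM; apply: lerch_boundP => //.
  exact: (normc_inv_subr_le (w1 p)).
split; first exact: (cintegrable_le mf ig fg).
pose u (m : nat) := z1 ^+ m * cpowN (m%:R + a) s1 *
  csum (fun n => z2 ^+ n * cpowN (m%:R + n.+1%:R + a) s2).
(* Convergence is proved for the partial sums already multiplied by the Gamma factors, since these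
   are the integrals of [h N]. *)
apply: (mul_csum_ccvg (u := u)).
suff E N : cGamma s1 * cGamma s2 * \sum_(0 <= k < N) u k = Cint lambda2 (h N).
  have -> : (fun N => cGamma s1 * cGamma s2 * \sum_(0 <= k < N) u k) =
    (fun N => Cint lambda2 (h N)) by apply/funext.
  exact: ccvg_Cint_dominated mh hf ig hg.
have k1 k : 0 < a + k%:R by rewrite ltr_pwDl.
have k2 k : 1 < 1 + a + k%:R by rewrite (lt_le_trans c1)// lerDl.
pose t k (p : R * R) := z1 ^+ k *
  (gamma_kernel s1 (a + k%:R) p.1 * inner_kernel s2 (1 + a + k%:R) z2 p.2).
have tE k : cintegrable lambda2 (t k) /\ Cint lambda2 (t k) = cGamma s1 * cGamma s2 * u k.
  have [_ iI IE] := inner_csum s2_gt1 (k2 k) z2_le1.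
  have [iP PE] := Cint_prod (cintegrable_gamma_kernel s1_gt0 (k1 k)) iI.
  have [it ->] := CintZl (z1 ^+ k) iP; split => //.
  rewrite PE -IE -cGamma_cpowN// /u (addrC k%:R a).
  have -> : (fun n => z2 ^+ n * cpowN (k%:R + n.+1%:R + a) s2) =
      (fun n => z2 ^+ n * cpowN (1 + a + k%:R + n%:R) s2).
    by apply/funext => n; congr (_ * cpowN _ _); rewrite -natr1; ring.
  by ring.
rewrite mulr_sumr; under eq_bigr => k _ do rewrite -(tE k).2.
rewrite -Cint_sum; last by move=> k; case: (tE k).
congr Cint; apply/funext => p; rewrite /h mulr_sumr; apply: eq_bigr => k _.
rewrite /t /D /w /inner_kernel !gamma_kernel_addn /lerch_ratio exprMn opprD expRD.
by rewrite rmorphM/= exprMn; ring.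
Qed.

End integral_representation.

(** * Measures with a density *)

Section density.
Context {d : measure_display} {T : measurableType d} {R : realType}.
Variables (mu : {sigma_finite_measure set T -> \bar R}) (q : T -> R).

(* The proofs are arguments so that the measure instances below need no side condition. *)
Definition density_measure (q0 : forall x, 0 <= q x)
    (iq : mu.-integrable setT (EFin \o q)) (A : set T) : \bar R :=
  (\int[mu]_(x in A) (q x)%:E)%E.

Hypotheses (q0 : forall x, 0 <= q x) (iq : mu.-integrable setT (EFin \o q)).
Local Notation nu := (density_measure q0 iq).

Let mq : measurable_fun setT q.
Proof. exact/measurable_EFinP/(measurable_int _ iq). Qed.

Let density0 : nu set0 = 0%E.
Proof. by rewrite /density_measure integral_set0. Qed.

Let density_ge0 A : (0 <= nu A)%E.
Proof. by apply: integral_ge0 => x _; rewrite lee_fin. Qed.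

Let density_sigma_additive : semi_sigma_additive nu.
Proof.
move=> F mF tF mUF; rewrite /density_measure; apply: cvg_toP.
  apply: ereal_nondecreasing_is_cvgn => m n mn.
  by apply: lee_sum_nneg_natr => // k _ _; exact: density_ge0.
rewrite ge0_integral_bigcup//=.
- by apply/measurable_EFinP; exact: measurable_funTS.
- by move=> x _; rewrite lee_fin.
Qed.

HB.instance Definition _ := isMeasure.Build _ _ _
  nu density0 density_ge0 density_sigma_additive.

Let density_fin : fin_num_fun nu.
Proof.
move=> A mA; rewrite /density_measure; apply: integrable_fin_num => //.
exact: integrableS iq.
Qed.

HB.instance Definition _ := Measure_isFinite.Build _ _ _ nu density_fin.

Lemma density_measure_dominates : nu `<< mu.
Proof.
apply/null_content_dominatesP => A mA muA0; rewrite /density_measure.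
apply: null_set_integral => //.
by apply/measurable_EFinP; exact: measurable_funTS.
Qed.

(** The Radon-Nikodym derivative and [q] have the same integral over every measurable set, so they
    agree almost everywhere, and the change of variables for the former applies. *)
Lemma Rintegral_density (g : T -> R) : measurable_fun setT g ->
  (exists M, forall x, `|g x| <= M) ->
  \int[nu]_x g x = \int[mu]_x (g x * q x).
Proof.
move=> mg [M gM].
have ig : (nu : {measure set T -> \bar R}).-integrable setT (EFin \o g).
  apply: measurable_bounded_integrable => //.
    by rewrite ltey_eq fin_num_measure.
  by exists M; split; [exact: num_real | move=> x Mx y _ /=; rewrite (le_trans (gM y))// ltW].
have dom := density_measure_dominates.
pose f := Radon_Nikodym (charge_of_finite_measure nu) mu.
have i_f : mu.-integrable setT f by exact: Radon_Nikodym_integrable.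
have fq : ae_eq mu setT f (EFin \o q).
  apply: integral_ae_eq => //; first exact/measurable_EFinP.
  by move=> E _ mE; rewrite /f -Radon_Nikodym_integral.
rewrite /Rintegral; congr fine.
rewrite -(Radon_Nikodym_change_of_variables dom measurableT ig).
apply: ae_eq_integral => //.
- by apply: emeasurable_funM; [exact/measurable_EFinP | exact: measurable_int i_f].
- by apply/measurable_EFinP; exact: measurable_funM.
- have := ae_eqe_mul2l (EFin \o g) fq; apply: filterS => x H xT.
  by rewrite H//= EFinM.
Qed.

End density.

(** * Negligible sets of the plane *)

Section lebesgue_plane.
Context {R : realType}.
Local Notation lambda := (@lebesgue_measure R).
Local Notation lambda2 := (lambda \x lambda)%E.

(** A ball of the product is a product of two intervals of positive length. *)
Lemma ball_not_negligible (p : R * R) (e : R) : 0 < e ->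
  ~ lambda2.-negligible (ball p e).
Proof.
move=> e0.
have -> : ball p e = ball p.1 e `*` ball p.2 e by [].
have mB (x : R) : measurable (ball x e).
  exact: measurable_ball.
move=> /negligibleP => /(_ (measurableX (mB _) (mB _))) H.
have : (lambda (ball p.1 e) * lambda (ball p.2 e) = 0)%E.
  by rewrite -product_measure1E//; [exact: mB | exact: mB].
rewrite !lebesgue_measure_ball ?ltW//.
by rewrite -EFinM => -[] /eqP; rewrite mulf_eq0 mulrn_eq0/= gt_eqF.
Qed.

(** A nonzero value would persist on a ball, which is not negligible. *)
Lemma ae_continuous_eq0 (f : R * R -> R) : continuous f ->
  {ae lambda2, forall p, f p = 0} -> forall p, f p = 0.
Proof.
move=> cf f0 p; apply/eqP/negP => /negP fp.
have : \forall y \near p, f y != 0.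
  exact: (cvgr_neq0 _ (cf p) fp).
move=> /nbhs_ballP[e e0 pe]; apply: (@ball_not_negligible p e e0).
apply: negligibleS f0 => y py /= fy0; have := pe y py.
by rewrite /= fy0 eqxx.
Qed.

End lebesgue_plane.

Section measure_copies.
Context {d : measure_display} {T : measurableType d} {R : realType}.
Variable m : {measure set T -> \bar R}.

(** Taking the proof as an argument lets a measure known only through its properties carry the
    finite structure; [probability_copy] does the same for total mass one. *)
Definition finite_copy of fin_num_fun m : set T -> \bar R := m.
HB.instance Definition _ (fm : fin_num_fun m) := Measure.copy (finite_copy fm) m.
HB.instance Definition _ (fm : fin_num_fun m) :=
  Measure_isFinite.Build _ _ _ (finite_copy fm) fm.

Definition probability_copy of m setT = 1%E : set T -> \bar R := m.
HB.instance Definition _ (m1 : m setT = 1%E) := Measure.copy (probability_copy m1) m.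
HB.instance Definition _ (m1 : m setT = 1%E) :=
  Measure_isProbability.Build _ _ _ (probability_copy m1) m1.

End measure_copies.

(** * Images of measures with a density *)

Section image_density.
Context {d d' : measure_display} {T : measurableType d} {T' : measurableType d'}.
Context {R : realType}.
Variables (mu : {sigma_finite_measure set T -> \bar R}) (q : T -> R) (X : T -> T').
Hypotheses (q0 : forall x, 0 <= q x) (iq : mu.-integrable setT (EFin \o q)).
Hypothesis mX : measurable_fun setT X.
Local Notation nu := (density_measure q0 iq).

Lemma Rintegral_image_density (m : {measure set T' -> \bar R}) (g : T' -> R) :
  (forall A, m A = nu (X @^-1` A)) ->
  measurable_fun setT g -> (exists M, forall x, `|g x| <= M) ->
  \int[m]_x g x = \int[mu]_x (g (X x) * q x).
Proof.
move=> mE mg [M gM]; have mgX : measurable_fun setT (g \o X) by exact: measurableT_comp.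
have ig : (nu : {measure set T -> \bar R}).-integrable setT (EFin \o (g \o X)).
  apply: measurable_bounded_integrable => //; first by rewrite ltey_eq fin_num_measure.
  by exists M; split; [exact: num_real | move=> x Mx y _ /=; rewrite (le_trans (gM _))// ltW].
rewrite -(Rintegral_density q0 iq mgX); last by exists M => x /=.
rewrite /Rintegral; congr fine.
rewrite -[RHS](@integral_pushforward _ _ _ _ _ X mX nu setT (EFin \o g))//.
- by apply: eq_measure_integral => A mA _; exact: mE.
- exact/measurable_EFinP.
Qed.

Lemma image_density_measure : exists m : {measure set T' -> \bar R},
  forall A, m A = nu (X @^-1` A).
Proof. by pose m : {measure set T' -> \bar R} := pushforward nu X; exists (m mX). Qed.

Lemma finite_image_density : exists m : {finite_measure set T' -> \bar R},
  (forall A, m A = (\int[mu]_(x in X @^-1` A) (q x)%:E)%E) /\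
  forall g : T' -> R, measurable_fun setT g -> (exists M, forall x, `|g x| <= M) ->
    \int[m]_x g x = \int[mu]_x (g (X x) * q x).
Proof.
have [m mE] := image_density_measure.
have fm : fin_num_fun m.
  move=> A mA; rewrite mE; apply: fin_num_measure.
  by rewrite -[X in measurable X]setTI; exact: mX.
exists (finite_copy fm); split; first exact: mE.
by move=> g; apply: Rintegral_image_density => A; exact: mE.
Qed.

Lemma probability_image_density : \int[mu]_x q x = 1 -> exists m : probability T' R,
  (forall A, m A = (\int[mu]_(x in X @^-1` A) (q x)%:E)%E) /\
  forall g : T' -> R, measurable_fun setT g -> (exists M, forall x, `|g x| <= M) ->
    \int[m]_x g x = \int[mu]_x (g (X x) * q x).
Proof.
move=> q1; have [m mE] := image_density_measure.
have m1 : m setT = 1%E.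
  rewrite mE preimage_setT -[LHS]fineK ?[fine _]q1//.
  exact: (integrable_fin_num measurableT iq).
exists (probability_copy m1); split; first exact: mE.
by move=> g; apply: Rintegral_image_density => A; exact: mE.
Qed.

End image_density.

(* A separate constant: on [_ \x _] itself the library's sigma-finiteness instance is
   shadowed by the one for subprobability measures. *)
Definition plane_measure (R : realType) :
    set (measurableTypeR R * measurableTypeR R) -> \bar R :=
  (@lebesgue_measure R \x @lebesgue_measure R)%E.
Arguments plane_measure : clear implicits.

Section plane_measure.
Variable R : realType.
Local Notation lambda := (@lebesgue_measure R).

HB.instance Definition _ := Measure.copy (plane_measure R) (lambda \x lambda)%E.

Let plane_measure_sigma_finite : sigma_finite setT (plane_measure R).
Proof.
pose B n : set R := ball 0 n%:R.
have mB n : @measurable _ (measurableTypeR R) (B n) by exact: measurable_ball.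
exists (fun n => B n `*` B n).
  apply/seteqP; split => // -[x y] _.
  have [n] := exists_norm_lt_nat (Num.max `|x| `|y|).
  rewrite ger0_norm ?le_max ?normr_ge0// gt_max => /andP[xn yn].
  by exists n => //; split; rewrite /B -ball_normE /= sub0r normrN.
move=> n; split; first exact: measurableX.
rewrite [ltLHS](_ : _ = (lambda (B n) * lambda (B n))%E); last exact: product_measure1E.
by rewrite !lebesgue_measure_ball// -EFinM ltry.
Qed.

HB.instance Definition _ := Measure_isSigmaFinite.Build _ _ _
  (plane_measure R) plane_measure_sigma_finite.

End plane_measure.

(** * The kernel, its normalization and the explicit density *)

Section normalized_kernel.
Context {R : realType}.
Local Notation lambda := (@lebesgue_measure R).
Local Notation lambda2 := (lambda \x lambda)%E.

Lemma normc_le1 (z : R[i]) : `|z| <= 1 -> normc z <= 1.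
Proof. by case: z => x y; rewrite complex.normc_def lecR. Qed.

Lemma gamma_kernel_cis (sig t c x : R) :
  gamma_kernel (sig +i* t) c x = cis (t * x) * gamma_kernel (sig +i* 0) c x.
Proof. by rewrite /gamma_kernel /= mul0r cis0 mulr1 mulrC. Qed.

(** The imaginary parts of the arguments enter only through a character of the plane, which makes
    [fsig] the Fourier transform of one fixed kernel. *)
Lemma lerch_kernel_cis (a : R) (z1 z2 : R[i]) (sig1 sig2 t1 t2 : R) p :
  lerch_kernel a z1 z2 (sig1 +i* t1) (sig2 +i* t2) p =
  cis (t1 * p.1 + t2 * p.2) * lerch_kernel a z1 z2 (sig1 +i* 0) (sig2 +i* 0) p.
Proof.
rewrite /lerch_kernel /inner_kernel gamma_kernel_cis (gamma_kernel_cis sig2) cisD.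
by ring.
Qed.

Variables (a : R) (z1 z2 : R[i]) (sig1 sig2 : R).
Hypotheses (a0 : 0 < a) (a1 : a <= 1) (z1_le1 : `|z1| <= 1) (z2_le1 : `|z2| <= 1).
Hypotheses (sig1_gt0 : 0 < sig1) (sig2_gt1 : 1 < sig2) (sig12_gt2 : 2 < sig1 + sig2).

Local Notation K := (lerch_kernel a z1 z2 (sig1 +i* 0) (sig2 +i* 0)).

Lemma fsig_fourier t1 t2 :
  cintegrable lambda2 (fun p => cis (t1 * p.1 + t2 * p.2) * K p) /\
  fsig sig1 sig2 a z1 z2 t1 t2 = Cint lambda2 (fun p => cis (t1 * p.1 + t2 * p.2) * K p).
Proof.
have [] := @lerch_representation R a z1 z2 (sig1 +i* t1) (sig2 +i* t2) a0 a1
  (normc_le1 z1_le1) (normc_le1 z2_le1) sig1_gt0 sig2_gt1 sig12_gt2.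
rewrite (_ : lerch_kernel _ _ _ _ _ = fun p => cis (t1 * p.1 + t2 * p.2) * K p)//.
by apply/funext => p; exact: lerch_kernel_cis.
Qed.

Lemma cintegrable_lerch_kernel : cintegrable lambda2 K.
Proof.
have [+ _] := fsig_fourier 0 0; congr cintegrable; apply/funext => p.
by rewrite !mul0r addr0 cis0 mul1r.
Qed.

Lemma fsig0E : fsig sig1 sig2 a z1 z2 0 0 = Cint lambda2 K.
Proof.
have [_ ->] := fsig_fourier 0 0; congr Cint; apply/funext => p.
by rewrite !mul0r addr0 cis0 mul1r.
Qed.

Lemma Fsig_fourier t1 t2 : Fsig sig1 sig2 a z1 z2 t1 t2 =
  Cint lambda2 (fun p => cis (t1 * p.1 + t2 * p.2) *
    ((fsig sig1 sig2 a z1 z2 0 0)^-1 * K p)).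
Proof.
have [i_f E] := fsig_fourier t1 t2.
rewrite /Fsig E mulrC -(CintZl _ i_f).2; congr Cint; apply/funext => p.
by rewrite mulrCA.
Qed.

Definition real_lerch_kernel (p : R * R) : R :=
  expR (sig1 * p.1 - a * expR p.1) * (expR (sig2 * p.2 - (1 + a) * expR p.2) *
    (1 - complex.Re z2 * expR (- expR p.2))^-1) *
  (1 - complex.Re z1 * expR (- (expR p.1 + expR p.2)))^-1.

Hypotheses (z1_real : complex.Im z1 = 0) (z2_real : complex.Im z2 = 0).

Lemma lerch_kernel_real p : K p = (real_lerch_kernel p)%:C.
Proof.
have z1E : z1 = (complex.Re z1)%:C by apply: complexP.
have z2E : z2 = (complex.Re z2)%:C by apply: complexP.
rewrite /lerch_kernel /inner_kernel /gamma_kernel /lerch_ratio /= !mul0r cis0 !mulr1.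
rewrite {1}z1E {1}z2E (_ : (1 : R[i]) = 1%:C)//.
by rewrite -!(rmorphM, rmorphB, fmorphV).
Qed.

Lemma Re_le1 (z : R[i]) : `|z| <= 1 -> complex.Re z <= 1.
Proof.
by move=> /normc_le1; apply: le_trans; rewrite (le_trans (ler_norm _))// norm_Re_le.
Qed.

Lemma sub_Re_expRN_gt0 (z : R[i]) (y : R) : `|z| <= 1 -> 0 < y -> 0 < 1 - complex.Re z * expR (- y).
Proof.
move=> /Re_le1 zle y0; have : expR (- y) < 1 by rewrite -[ltRHS]expR0 ltr_expR oppr_lt0.
by have := expR_gt0 (- y); nra.
Qed.

Lemma real_lerch_kernel_gt0 p : 0 < real_lerch_kernel p.
Proof.
by rewrite /real_lerch_kernel !mulr_gt0 ?expR_gt0 ?invr_gt0 ?sub_Re_expRN_gt0 ?addr_gt0 ?expR_gt0.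
Qed.

Lemma integrable_real_lerch_kernel :
  lambda2.-integrable setT (EFin \o real_lerch_kernel).
Proof.
have [+ _] := cintegrable_lerch_kernel; apply: eq_integrable => // p _.
by rewrite /= lerch_kernel_real.
Qed.

Lemma fsig0_real : fsig sig1 sig2 a z1 z2 0 0 = (\int[lambda2]_p real_lerch_kernel p)%:C.
Proof.
rewrite fsig0E /Cint; apply: complexP => /=.
  by apply: eq_Rintegral => p _; rewrite lerch_kernel_real.
under eq_Rintegral do rewrite lerch_kernel_real /=.
by rewrite Rintegral_cst// mul0r.
Qed.

(** If the integral were zero, the kernel would vanish almost everywhere; being positive everywhere,
    it would make a ball negligible. *)
Lemma Rintegral_real_lerch_kernel_gt0 : 0 < \int[lambda2]_p real_lerch_kernel p.
Proof.
have ik := integrable_real_lerch_kernel.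
have k0 := real_lerch_kernel_gt0.
rewrite lt0r Rintegral_ge0 ?andbT; last by move=> p _; exact: ltW.
apply/eqP => I0.
have E : (\int[lambda2]_p (real_lerch_kernel p)%:E = 0)%E.
  rewrite -[LHS](fineK (integrable_fin_num measurableT ik)).
  by rewrite -[fine _]/(\int[lambda2]_p real_lerch_kernel p) I0.
have := ae_eq_integral_abs lambda2 measurableT (measurable_int _ ik).
under eq_integral do rewrite /= gtr0_norm//.
move=> [/(_ E) ae0 _].
apply: (@ball_not_negligible R (0, 0) 1 ltr01).
apply: negligibleS ae0 => p _ /= /(_ Logic.I) /eqP.
by rewrite eqe gt_eqF.
Qed.

(** Factoring [e^Y] and [e^(X + Y)] out of the denominators, with [X = e^eta] and [Y = e^theta],
    turns the exponent [(1 - a) (X + Y)] into [- a X - (1 + a) Y]. *)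
Lemma PdensE p : Pdens sig1 sig2 a z1 z2 p =
  (\int[lambda2]_p real_lerch_kernel p)^-1 * real_lerch_kernel p.
Proof.
rewrite /Pdens fsig0_real [complex.Re _%:C]/=.
have I0 := Rintegral_real_lerch_kernel_gt0; move: I0; set I := \int[_]_p _ => I0.
case: p => x y /=; rewrite /real_lerch_kernel /=.
have X0 := expR_gt0 x; have Y0 := expR_gt0 y.
move: X0 Y0; set X := expR x; set Y := expR y => X0 Y0.
have d2 := sub_Re_expRN_gt0 z2_le1 Y0.
have d1 := sub_Re_expRN_gt0 z1_le1 (addr_gt0 X0 Y0).
have E2 : expR Y - complex.Re z2 = expR Y * (1 - complex.Re z2 * expR (- Y)).
  by rewrite mulrBr mulr1 mulrCA -expRD subrr expR0 mulr1.
have E1 : expR (X + Y) - complex.Re z1 = expR (X + Y) * (1 - complex.Re z1 * expR (- (X + Y))).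
  by rewrite mulrBr mulr1 mulrCA -expRD subrr expR0 mulr1.
rewrite E1 E2.
have -> : expR (sig1 * x) * expR (sig2 * y) * expR ((1 - a) * (X + Y)) =
    expR (sig1 * x - a * X) * expR (sig2 * y - (1 + a) * Y) * (expR Y * expR (X + Y)).
  by rewrite -!expRD; congr expR; ring.
field.
by rewrite !gt_eqF ?expR_gt0.
Qed.

End normalized_kernel.

(** * Real parameters and positive densities *)

Section characteristic_functions.
Context {R : realType}.
Local Notation lambda := (@lebesgue_measure R).
Local Notation lambda2 := (lambda \x lambda)%E.

(* The display of [measurableTypeR] and the default display of [R] are different
   opaque constants; the identity map transports measures from one to the other. *)
Definition plane_id (p : measurableTypeR R * measurableTypeR R) : R * R := p.

Lemma measurable_plane_id : measurable_fun setT plane_id.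
Proof. by move=> _ A mA; rewrite setTI. Qed.

Lemma charfun2_density (P : probability (R * R)%type R) (q : R * R -> R) t1 t2 :
  (forall g : R * R -> R, measurable_fun setT g -> (exists M, forall x, `|g x| <= M) ->
    \int[P]_x g x = \int[lambda2]_x (g x * q x)) ->
  charfun2 P t1 t2 = Cint lambda2 (fun p => cis (t1 * p.1 + t2 * p.2) * (q p)%:C).
Proof.
move=> H; have [mc [M cM]] := bounded_measurable_cos t1 t2.
have [ms [N sN]] := bounded_measurable_sin t1 t2.
rewrite /charfun2 /Cint; congr (_ +i* _).
- rewrite H//; last by exists M.
  by apply: eq_Rintegral => p _; rewrite ReM /= mulr0 subr0.
- rewrite H//; last by exists N.
  by apply: eq_Rintegral => p _; rewrite ImM /= mulr0 add0r.
Qed.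

Lemma charfun2_unique (P Q : probability (R * R)%type R) :
  (forall t1 t2, charfun2 P t1 t2 = charfun2 Q t1 t2) ->
  forall A, measurable A -> P A = Q A.
Proof.
move=> PQ; apply: charfun_measure_unique => t1 t2.
by have [] := PQ t1 t2.
Qed.

Lemma charfun20 (P : probability (R * R)%type R) : charfun2 P 0 0 = 1.
Proof.
rewrite /charfun2; apply: complexP => /=.
- under eq_Rintegral do rewrite !mul0r addr0 cos0.
  rewrite Rintegral_cst// mul1r -[RHS]/(fine 1%E); congr fine.
  exact: probability_setT.
- under eq_Rintegral do rewrite !mul0r addr0 sin0.
  by rewrite Rintegral_cst// mul0r.
Qed.

(** For real parameters [f(0)^-1 K] is the nonnegative function [Pdens] of integral one, and its
    Fourier transform is [Fsig]. *)
Lemma Fsig_charfun (a : R) (z1 z2 : R[i]) (sig1 sig2 : R) :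
  0 < a -> a <= 1 -> `|z1| <= 1 -> `|z2| <= 1 ->
  0 < sig1 -> 1 < sig2 -> 2 < sig1 + sig2 ->
  complex.Im z1 = 0 -> complex.Im z2 = 0 ->
  exists P : probability (R * R)%type R,
    (forall A, P A = (\int[lambda2]_(p in A) (Pdens sig1 sig2 a z1 z2 p)%:E)%E) /\
    forall t1 t2, charfun2 P t1 t2 = Fsig sig1 sig2 a z1 z2 t1 t2.
Proof.
move=> a0 a1 z1l z2l s1 s2 s12 z1r z2r.
have PE := PdensE a0 a1 z1l z2l s1 s2 s12 z1r z2r.
have I0 := Rintegral_real_lerch_kernel_gt0 a0 a1 z1l z2l s1 s2 s12 z1r z2r.
have k0 := real_lerch_kernel_gt0 a sig1 sig2 z1l z2l.
have ik := integrable_real_lerch_kernel a0 a1 z1l z2l s1 s2 s12 z1r z2r.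
have fE := fsig0_real a0 a1 z1l z2l s1 s2 s12 z1r z2r.
move: PE I0 ik fE; set k := real_lerch_kernel _ _ _ _ _; set I := \int[_]_p _ => PE I0 ik fE.
have P0 p : 0 <= Pdens sig1 sig2 a z1 z2 p by rewrite PE mulr_ge0 ?invr_ge0 ?ltW.
have iP : lambda2.-integrable setT (EFin \o Pdens sig1 sig2 a z1 z2).
  apply: (eq_integrable _ _ _ _ (integrableZl _ I^-1 ik)) => // p _.
  by rewrite /= PE.
have P1 : \int[lambda2]_p Pdens sig1 sig2 a z1 z2 p = 1.
  under eq_Rintegral do rewrite PE.
  by rewrite RintegralZl// mulVf ?gt_eqF.
have [P [PA Pg]] := @probability_image_density _ _ (measurableTypeR R * measurableTypeR R)%type
  (R * R)%type R (plane_measure R) _ plane_id P0 iP measurable_plane_id P1.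
exists P; split => // t1 t2; rewrite (charfun2_density _ _ Pg).
rewrite (Fsig_fourier a0 a1 z1l z2l s1 s2 s12); congr Cint; apply/funext => p.
by rewrite PE (lerch_kernel_real _ _ _ z1r z2r) fE rmorphM fmorphV.
Qed.

End characteristic_functions.

(** * Necessity of real parameters *)

Section real_parameters.
Context {R : realType}.
Local Notation lambda := (@lebesgue_measure R).
Local Notation lambda2 := (lambda \x lambda)%E.

Lemma integrable_bounded_mul (g h : R * R -> R) : measurable_fun setT g ->
  (forall p, `|g p| <= 1) -> lambda2.-integrable setT (EFin \o h) ->
  lambda2.-integrable setT (EFin \o (fun p => g p * h p)).
Proof.
move=> mg g1 ih; apply: le_integrable (ih) => //.
  apply/measurable_EFinP; apply: measurable_funM => //.
  by apply/measurable_EFinP; exact: measurable_int ih.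
by move=> p _ /=; rewrite lee_fin normrM ler_piMl.
Qed.

(** The densities [|q| + q] and [|q| - q] are nonnegative and have the same Fourier transform.
    Uniqueness for finite measures makes them equal almost everywhere, and their difference is
    [2 q]. *)
Lemma fourier_eq0_ae (q : R * R -> R) : lambda2.-integrable setT (EFin \o q) ->
  (forall t1 t2, \int[lambda2]_p (cos (t1 * p.1 + t2 * p.2) * q p) = 0 /\
                 \int[lambda2]_p (sin (t1 * p.1 + t2 * p.2) * q p) = 0) ->
  {ae lambda2, forall p, q p = 0}.
Proof.
move=> iq H.
have inq : lambda2.-integrable setT (EFin \o (fun p => `|q p|)).
  exact: integrable_norm.
pose d1 p := `|q p| + q p; pose d2 p := `|q p| - q p.
have i1 : lambda2.-integrable setT (EFin \o d1).
  exact: (eq_integrable _ _ _ _ (integrableD _ inq iq)).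
have i2 : lambda2.-integrable setT (EFin \o d2).
  exact: (eq_integrable _ _ _ _ (integrableB _ inq iq)).
have d10 p : 0 <= d1 p by rewrite -lerBlDr sub0r ler_normr lexx orbT.
have d20 p : 0 <= d2 p by rewrite subr_ge0 ler_norm.
have [m1 [m1E m1g]] := @finite_image_density _ _ (measurableTypeR R * measurableTypeR R)%type
  (R * R)%type R (plane_measure R) _ (@plane_id R) d10 i1 (@measurable_plane_id R).
have [m2 [m2E m2g]] := @finite_image_density _ _ (measurableTypeR R * measurableTypeR R)%type
  (R * R)%type R (plane_measure R) _ (@plane_id R) d20 i2 (@measurable_plane_id R).
have same (g : R * R -> R) : measurable_fun setT g -> (forall p, `|g p| <= 1) ->
    \int[lambda2]_p (g p * q p) = 0 -> \int[m1]_p g p = \int[m2]_p g p.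
  move=> mg g1 gq0; rewrite m1g ?m2g//; try by exists 1.
  rewrite /plane_id.
  have e1 : \int[lambda2]_p (g p * d1 p) = \int[lambda2]_p (g p * `|q p|).
    under eq_Rintegral do rewrite mulrDr.
    by rewrite RintegralD ?gq0 ?addr0//; exact: integrable_bounded_mul.
  have e2 : \int[lambda2]_p (g p * d2 p) = \int[lambda2]_p (g p * `|q p|).
    under eq_Rintegral do rewrite mulrBr.
    by rewrite RintegralB ?gq0 ?subr0//; exact: integrable_bounded_mul.
  by rewrite e1 e2.
have E : forall A, measurable A -> m1 A = m2 A.
  apply: charfun_measure_unique => t1 t2; have [Hc Hs] := H t1 t2; split.
  - by apply: same => //; [case: (bounded_measurable_cos t1 t2) | move=> p; exact: norm_cos_le1].
  - by apply: same => //; [case: (bounded_measurable_sin t1 t2) | move=> p; exact: norm_sin_le1].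
have : ae_eq lambda2 setT (EFin \o d1) (EFin \o d2).
  apply: integral_ae_eq => //; first exact: measurable_int i2.
  by move=> A _ mA; have := E A mA; rewrite m1E m2E.
apply: filterS => p /(_ Logic.I) [] /eqP.
by rewrite /d1 /d2 => /eqP; lra.
Qed.

(** The imaginary part of [D^-1] is [- Im D / |D|^2], and the denominator vanishes only for [D = 0],
    where the claim holds as well. *)
Lemma Im_real_div_eq0 (r : R) (D : R[i]) : 0 < r ->
  complex.Im (r%:C * D^-1) = 0 -> complex.Im D = 0.
Proof.
case: D => x y r0; rewrite ImM /= mul0r addr0 => /eqP.
rewrite mulf_eq0 gt_eqF//= oppr_eq0 mulf_eq0 invr_eq0 => /orP[/eqP//|].
by rewrite paddr_eq0 ?sqr_ge0// !sqrf_eq0 => /andP[_ /eqP].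
Qed.

(** Up to a positive factor the kernel is the inverse of a product of two affine functions, so its
    being real is a polynomial condition. *)
Lemma lerch_kernel_quotient (a sig1 sig2 : R) (z1 z2 : R[i]) (p : R * R) :
  exists2 r : R, 0 < r & lerch_kernel a z1 z2 (sig1 +i* 0) (sig2 +i* 0) p =
    r%:C * (((expR (expR p.2))%:C - z2) * ((expR (expR p.1 + expR p.2))%:C - z1))^-1.
Proof.
have F (z : R[i]) (y : R) : 1 - lerch_ratio z y = (expR (- y))%:C * ((expR y)%:C - z).
  by rewrite /lerch_ratio mulrBr -rmorphM/= -expRD addNr expR0 mulrC.
have FV (y : R) : ((expR (- y))%:C)^-1 = (expR y)%:C by rewrite -fmorphV/= expRN invrK.
exists (expR (sig1 * p.1 - a * expR p.1) * (expR (sig2 * p.2 - (1 + a) * expR p.2) *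
    expR (expR p.2)) * expR (expR p.1 + expR p.2)).
  by rewrite !mulr_gt0 ?expR_gt0.
rewrite /lerch_kernel /inner_kernel /gamma_kernel /= !mul0r cis0 !mulr1.
rewrite !F !invfM !FV !rmorphM /=.
by ring.
Qed.

Lemma expR_expR_surj (Y W : R) : 1 < Y -> Y < W ->
  exists p : R * R, expR (expR p.2) = Y /\ expR (expR p.1 + expR p.2) = W.
Proof.
move=> Y1 YW; have Y0 : 0 < Y by lra. have W0 : 0 < W by lra.
exists (ln (ln W - ln Y), ln (ln Y)) => /=.
rewrite !lnK ?posrE ?ln_gt0 ?subr_gt0 ?ltr_ln ?posrE// subrK.
by rewrite !lnK.
Qed.

Lemma Fsig_charfun_real (a sig1 sig2 : R) (z1 z2 : R[i])
    (mu : probability (R * R)%type R) :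
  0 < a -> a <= 1 -> `|z1| <= 1 -> `|z2| <= 1 ->
  0 < sig1 -> 1 < sig2 -> 2 < sig1 + sig2 ->
  (forall t1 t2, charfun2 mu t1 t2 = Fsig sig1 sig2 a z1 z2 t1 t2) ->
  complex.Im z1 = 0 /\ complex.Im z2 = 0.
Proof.
move=> a0 a1 z1l z2l sg1 sg2 sg12 muF.
set f0 := fsig sig1 sig2 a z1 z2 0 0.
(* If [f0] were [0], the inverse convention would make [Fsig] vanish, while a characteristic
   function is [1] at the origin. *)
have f0N : f0 != 0.
  apply/eqP => f00; have := muF 0 0; rewrite charfun20 /Fsig -/f0 f00 mul0r.
  by move/eqP; rewrite oner_eq0.
pose Q p := f0^-1 * lerch_kernel a z1 z2 (sig1 +i* 0) (sig2 +i* 0) p.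
have [iQr iQi] : cintegrable lambda2 Q.
  by have [] := CintZl f0^-1 (cintegrable_lerch_kernel a0 a1 z1l z2l sg1 sg2 sg12).
pose ph (t1 t2 : R) (p : R * R) := t1 * p.1 + t2 * p.2.
have phN t1 t2 p : ph (- t1) (- t2) p = - ph t1 t2 p by rewrite /ph; ring.
have mc t1 t2 : measurable_fun setT (fun p => cos (ph t1 t2 p)).
  by case: (bounded_measurable_cos t1 t2).
have ms t1 t2 : measurable_fun setT (fun p => sin (ph t1 t2 p)).
  by case: (bounded_measurable_sin t1 t2).
have ic t1 t2 h : lambda2.-integrable setT (EFin \o h) ->
    lambda2.-integrable setT (EFin \o (fun p => cos (ph t1 t2 p) * h p)).
  by move=> ih; apply: integrable_bounded_mul => // p; exact: norm_cos_le1.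
have is_ t1 t2 h : lambda2.-integrable setT (EFin \o h) ->
    lambda2.-integrable setT (EFin \o (fun p => sin (ph t1 t2 p) * h p)).
  by move=> ih; apply: integrable_bounded_mul => // p; exact: norm_sin_le1.
pose X h t1 t2 := \int[lambda2]_p (cos (ph t1 t2 p) * h p).
pose Y h t1 t2 := \int[lambda2]_p (sin (ph t1 t2 p) * h p).
have XN h t1 t2 : X h (- t1) (- t2) = X h t1 t2.
  by apply: eq_Rintegral => p _; rewrite phN cosN.
have YN h t1 t2 : lambda2.-integrable setT (EFin \o h) -> Y h (- t1) (- t2) = - Y h t1 t2.
  move=> ih; rewrite -[RHS]mulN1r /Y -RintegralZl//; last exact: is_.
  by apply: eq_Rintegral => p _; rewrite phN sinN mulN1r mulNr.
pose q p := complex.Im (Q p); pose r p := complex.Re (Q p).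
have E t1 t2 : \int[mu]_p cos (ph t1 t2 p) = X r t1 t2 - Y q t1 t2 /\
    \int[mu]_p sin (ph t1 t2 p) = X q t1 t2 + Y r t1 t2.
  have := muF t1 t2; rewrite (Fsig_fourier a0 a1 z1l z2l sg1 sg2 sg12) => -[Ec Es]; split.
  - rewrite [LHS]Ec /X /Y -RintegralB//; [|exact: ic|exact: is_].
    by apply: eq_Rintegral => p _; rewrite ReM.
  - rewrite [LHS]Es /X /Y -RintegralD//; [|exact: ic|exact: is_].
    by apply: eq_Rintegral => p _; rewrite ImM.
(* The cosine transforms are even and the sine transforms odd. Comparing [E] at [t] and [- t]
   therefore gives [Y q = 0] from the real parts and [X q = 0] from the imaginary parts. *)
have q0 : {ae lambda2, forall p, q p = 0}.
  apply: fourier_eq0_ae => // t1 t2.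
  have [Ec Es] := E t1 t2; have [EcN EsN] := E (- t1) (- t2).
  rewrite !XN !YN// in EcN EsN.
  have CN : \int[mu]_p cos (ph (- t1) (- t2) p) = \int[mu]_p cos (ph t1 t2 p).
    by apply: eq_Rintegral => p _; rewrite phN cosN.
  have SN : \int[mu]_p sin (ph (- t1) (- t2) p) = - \int[mu]_p sin (ph t1 t2 p).
    rewrite -[RHS]mulN1r -RintegralZl//; last exact: bounded_measurable_integrable (bounded_measurable_sin t1 t2).
    by apply: eq_Rintegral => p _; rewrite phN sinN mulN1r.
  rewrite -/(X q t1 t2) -/(Y q t1 t2).
  by rewrite EcN Ec in CN; rewrite EsN Es in SN; split; lra.
(* The expansion of [Im (f0 (y - z2) (w - z1))], a polynomial of degree one in each variable. *)
pose J (y w : R) := complex.Im f0 * (y * w) - complex.Im (f0 * z1) * y -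
  complex.Im (f0 * z2) * w + complex.Im (f0 * z1 * z2).
have JE y w : J y w = complex.Im (f0 * ((y%:C - z2) * (w%:C - z1))).
  rewrite /J; case: (f0) => ? ?; case: (z1) => ? ?; case: (z2) => ? ? /=.
  by ring.
pose Jp (p : R * R) := J (expR (expR p.2)) (expR (expR p.1 + expR p.2)).
have cJ : continuous Jp.
  have c1 : continuous (fun p : R * R => expR p.1).
    by move=> p; apply: continuous_comp; [exact: cvg_fst | exact: continuous_expR].
  have c2 : continuous (fun p : R * R => expR p.2).
    by move=> p; apply: continuous_comp; [exact: cvg_snd | exact: continuous_expR].
  have cy : continuous (fun p : R * R => expR (expR p.2)).
    by move=> p; apply: continuous_comp; [exact: c2 | exact: continuous_expR].
  have cw : continuous (fun p : R * R => expR (expR p.1 + expR p.2)).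
    move=> p; apply: (@continuous_comp _ _ _ (fun p : R * R => expR p.1 + expR p.2) expR).
      by apply: continuousD; [exact: c1 | exact: c2].
    exact: continuous_expR.
  move=> p; apply: cvgD; last exact: cvg_cst.
  apply: cvgB; last by apply: cvgM; [exact: cvg_cst | exact: cw].
  apply: cvgB; last by apply: cvgM; [exact: cvg_cst | exact: cy].
  by apply: cvgM; [exact: cvg_cst | apply: cvgM; [exact: cy | exact: cw]].
(* [Q p] is a positive number divided by the complex number whose imaginary part is [Jp p], so [Jp]
   vanishes wherever [q] does. *)
have J0 : {ae lambda2, forall p, Jp p = 0}.
  apply: negligibleS q0 => p /= nJ q0p; apply: nJ; move: q0p; rewrite /q /Q.
  have [s s0 ->] := lerch_kernel_quotient a sig1 sig2 z1 z2 p.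
  rewrite mulrCA -invfM => /(Im_real_div_eq0 s0).
  by rewrite /Jp JE.
have {}J0 y w : 1 < y -> y < w -> J y w = 0.
  move=> y1 yw; have [p [<- <-]] := expR_expR_surj y1 yw.
  exact: (ae_continuous_eq0 cJ J0).
have lt (m n : nat) : (m < n)%N -> m%:R < n%:R :> R by rewrite ltr_nat.
(* The differences in [w] at [y = 2] and [y = 3] give [2 Im f0 = Im (f0 z2) = 3 Im f0], and the
   difference in [y] at [w = 4] gives [4 Im f0 = Im (f0 z1)]; all three vanish. *)
have J1 := J0 2 3 (lt 1 2 isT) (lt 2 3 isT); have J2 := J0 2 4 (lt 1 2 isT) (lt 2 4 isT).
have J3 := J0 3 4 (lt 1 3 isT) (lt 3 4 isT); have J4 := J0 3 5 (lt 1 3 isT) (lt 3 5 isT).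
have {}J1 : complex.Im f0 = 0 by move: J1 J2 J3 J4; rewrite /J; lra.
have {}J2 : complex.Im (f0 * z1) = 0 by move: J2 J3 J4; rewrite /J J1; lra.
have {}J3 : complex.Im (f0 * z2) = 0 by move: J3 J4; rewrite /J J1; lra.
have Rf0 : complex.Re f0 != 0.
  by apply: contra f0N => /eqP R0; apply/eqP; apply: complexP.
(* Here [f0] is a nonzero real number, so [f0 z] is real only if [z] is. *)
have real z : complex.Im (f0 * z) = 0 -> complex.Im z = 0.
  rewrite (ImM f0) J1 mul0r addr0 => /eqP.
  by rewrite mulf_eq0 (negbTE Rf0) => /eqP.
by split; exact: real.
Qed.

End real_parameters.

Theorem theorem2p4 (R : realType) (a : R) (z1 z2 : R[i])
  (ha : 0 < a) (ha1 : a <= 1)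
  (hz1 : 0 < `|z1|) (hz1' : `|z1| <= 1)
  (hz2 : 0 < `|z2|) (hz2' : `|z2| <= 1) :
  ((forall sig1 sig2 : R, 0 < sig1 -> 1 < sig2 -> 2 < sig1 + sig2 ->
      exists mu : probability (R * R)%type R,
        forall t1 t2 : R, charfun2 mu t1 t2 = Fsig sig1 sig2 a z1 z2 t1 t2)
   <-> (complex.Im z1 = 0 /\ complex.Im z2 = 0))
  /\
  (complex.Im z1 = 0 -> complex.Im z2 = 0 ->
   forall sig1 sig2 : R, 0 < sig1 -> 1 < sig2 -> 2 < sig1 + sig2 ->
   forall mu : probability (R * R)%type R,
     (forall t1 t2 : R, charfun2 mu t1 t2 = Fsig sig1 sig2 a z1 z2 t1 t2) ->
     forall A : set (R * R)%type, measurable A ->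
       mu A = (\int[(@lebesgue_measure R) \x (@lebesgue_measure R)]_(p in A)
                 (Pdens sig1 sig2 a z1 z2 p)%:E)%E).
Proof.
split.
  split.
    move=> H.
    have lt12 : 1 < 2 :> R by rewrite ltr1n.
    have lt23 : 2 < 1 + 2 :> R by rewrite ltrDr.
    (* One admissible pair of exponents already forces the parameters to be real. *)
    have [mu muF] := H 1 2 ltr01 lt12 lt23.
    exact: (Fsig_charfun_real ha ha1 hz1' hz2' ltr01 lt12 lt23 muF).
  move=> [z1r z2r] sig1 sig2 s1 s2 s12.
  have [P [_ PF]] := Fsig_charfun ha ha1 hz1' hz2' s1 s2 s12 z1r z2r.
  by exists P.
move=> z1r z2r sig1 sig2 s1 s2 s12 mu muF A mA.
have [P [PA PF]] := Fsig_charfun ha ha1 hz1' hz2' s1 s2 s12 z1r z2r.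
(* Both measures have characteristic function [Fsig], so the given one coincides with the one built
   from the density. *)
rewrite -PA; apply: charfun2_unique mA => t1 t2.
by rewrite muF PF.
Qed.
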